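(* Let $d=1$. For every $\theta\in(0,1)$ and every $\delta>0$ there exist a randomised, non-adaptive pooling scheme $\boldsymbol{G}$ for $n$ items using $$m \le (1+\delta)\cdot\frac{1+\sqrt{\theta}}{1-\sqrt{\theta}}\cdot m_{\mathrm{QGT}}^{\mathrm{inf}},\qquad m_{\mathrm{QGT}}^{\mathrm{inf}} = 2\,\frac{1-\theta}{\theta}\,k,\quad k=\lfloor n^{\theta}\rfloor,$$ pools, and a polynomial-time algorithm that, given $\boldsymbol{G}$ and the vector of measurement results $\hat{\boldsymbol{\sigma}}_{\boldsymbol{G}}$, outputs the ground truth $\boldsymbol{\sigma}$ with high probability (i.e. with probability tending to $1$ as $n\to\infty$).
   Context: Problem (quantitative group testing, i.e. the sparse pooled data problem with labels $\{0,1\}$): there are $n$ items $x_1,\dots,x_n$, and $k=\lfloor n^\theta\rfloor$ with $\theta\in(0,1)$ fixed. The ground truth $\boldsymbol{\sigma}=(\boldsymbol{\sigma}_1,\dots,\boldsymbol{\sigma}_n)$ is uniformly distributed over all vectors in $\{0,1\}^n$ with exactly $k$ entries equal to $1$; the number $k$ is known to the algorithm. A pooling scheme is a collection of $m$ pools $a_1,\dots,a_m$, each an arbitrary subset of $\{x_1,\dots,x_n\}$ (each item is contained in a pool at most once). It is identified with the bipartite graph on items and pools in which $x_i$ is adjacent to $a_j$ iff $x_i\in a_j$. The measurement result of pool $a_j$ is $\hat{\boldsymbol{\sigma}}_j=\sum_{i:\,x_i\in a_j}\mathbf{1}\{\boldsymbol{\sigma}_i=1\}$, and $\hat{\boldsymbol{\sigma}}_{\boldsymbol{G}}=(\hat{\boldsymbol{\sigma}}_1,\dots,\hat{\boldsymbol{\sigma}}_m)$.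 Non-adaptive means all pools are fixed in advance and measured in parallel, so no pool depends on $\boldsymbol{\sigma}$ or on any measurement result; randomised means the pools may be random (independent of $\boldsymbol{\sigma}$). The probability in ''with high probability'' is over both $\boldsymbol{\sigma}$ and the randomness of the scheme. Polynomial time means polynomial in $n$. *)

(* Defs.v *)
From mathcomp Require Import all_boot all_order all_algebra.
From mathcomp Require Import all_classical all_reals all_analysis.

Set Implicit Arguments.
Unset Strict Implicit.
Unset Printing Implicit Defensive.

Import Order.TTheory GRing.Theory Num.Theory.
Import numFieldNormedType.Exports.

Local Open Scope ring_scope.

(** * Quantitative group testing *)

Definition pooling (n m : nat) := {ffun 'I_m -> {set 'I_n}}.

Definition labels (n : nat) := {ffun 'I_n -> bool}.

Definition results (m : nat) := {ffun 'I_m -> nat}.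

Definition measure_pools (n m : nat) (G : pooling n m) (sigma : labels n) :
    results m :=
  [ffun j => (\sum_(i in G j) sigma i)%N].

Definition ground_truths (n k : nat) : {set labels n} :=
  [set sigma : labels n | (\sum_i sigma i)%N == k].

(* A randomised scheme is a law on the finite set of poolings.  It carries no
   dependence on the ground truth: the scheme is non-adaptive and independent
   of sigma. *)
Record pooling_scheme (R : realType) (n m : nat) := PoolingScheme {
  scheme_prob :> {ffun pooling n m -> R};
  scheme_prob_ge0 : forall G, 0 <= scheme_prob G;
  scheme_prob_sum1 : \sum_G scheme_prob G = 1
}.

Definition decoder (n m : nat) := pooling n m -> results m -> labels n.

(* Probability, under the product of the law of the scheme and the uniform law
   on [ground_truths n k], that the decoder returns sigma. *)
Definition success_prob (R : realType) (n m k : nat)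
    (P : pooling_scheme R n m) (D : decoder n m) : R :=
  \sum_(G : pooling n m) \sum_(sigma in ground_truths n k)
    P G * (#|ground_truths n k|%:R)^-1
        * (D G (measure_pools G sigma) == sigma)%:R.

Definition sparsity (R : realType) (theta : R) (n : nat) : nat :=
  Num.truncn (n%:R `^ theta).

Definition m_QGT_inf (R : realType) (theta : R) (n : nat) : R :=
  2 * ((1 - theta) / theta) * (sparsity theta n)%:R.

(** * Polynomial time

   Structured programs for a random access machine whose memory is a family of
   arrays of natural numbers.  Every arithmetic operation or memory access
   costs one unit.  Addition, truncated subtraction and halving are the only
   arithmetic: each lengthens numbers by at most one bit, so polynomial time
   here is Turing-machine polynomial time (multiplication at unit cost would
   break this). *)

Local Open Scope nat_scope.

Definition memory := nat -> nat -> nat.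

Inductive expr :=
| Const of nat
| Read of nat & expr
| Add of expr & expr
| Sub of expr & expr
| Half of expr.

Inductive program :=
| Skip
| Write of nat & expr & expr
| Seq of program & program
| If of expr & program & program
| While of expr & program.

Fixpoint eval (s : memory) (e : expr) : nat :=
  match e with
  | Const c => c
  | Read a e1 => s a (eval s e1)
  | Add e1 e2 => eval s e1 + eval s e2
  | Sub e1 e2 => eval s e1 - eval s e2
  | Half e1 => (eval s e1)./2
  end.

Fixpoint cost (e : expr) : nat :=
  match e with
  | Const _ => 1
  | Read _ e1 | Half e1 => (cost e1).+1
  | Add e1 e2 | Sub e1 e2 => (cost e1 + cost e2).+1
  end.

Definition update (s : memory) (a i v : nat) : memory :=
  fun a' i' => if (a' == a) && (i' == i) then v else s a' i'.

(* [exec p s t s']: started in s, p halts in s' after exactly t time units. *)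
Inductive exec : program -> memory -> nat -> memory -> Prop :=
| ExecSkip s : exec Skip s 1 s
| ExecWrite s a i v :
    exec (Write a i v) s (cost i + cost v).+1 (update s a (eval s i) (eval s v))
| ExecSeq p q s1 s2 s3 t u :
    exec p s1 t s2 -> exec q s2 u s3 -> exec (Seq p q) s1 (t + u) s3
| ExecIfTrue e p q s s' t :
    eval s e != 0 -> exec p s t s' -> exec (If e p q) s (cost e + t).+1 s'
| ExecIfFalse e p q s s' t :
    eval s e = 0 -> exec q s t s' -> exec (If e p q) s (cost e + t).+1 s'
| ExecWhileTrue e p s1 s2 s3 t u :
    eval s1 e != 0 -> exec p s1 t s2 -> exec (While e p) s2 u s3 ->
    exec (While e p) s1 (cost e + t + u).+1 s3
| ExecWhileFalse e p s :
    eval s e = 0 -> exec (While e p) s (cost e).+1 s.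

(* Array 0 starts with n, k, m; array 1 holds the results; array 2 holds the
   biadjacency matrix, row by row, one row per pool. *)
Definition input (n k m : nat) (G : pooling n m) (y : results m) : memory :=
  fun a p =>
    match a with
    | 0 => nth 0 [:: n; k; m] p
    | 1 => oapp y 0 (insub p)
    | 2 => [exists j : 'I_m, exists i : 'I_n, (p == j * n + i) && (i \in G j)]
    | _ => 0
    end.

(* The output is read from array 3. *)
Definition outputs (n : nat) (s : memory) (sigma : labels n) : Prop :=
  forall i : 'I_n, s 3 i = sigma i.

(* One program serves all n.  The bound is worst case: it covers every pooling
   and every vector of counts a pooling of n items could produce. *)
Definition poly_time (k m : nat -> nat) (D : forall n, decoder n (m n)) : Prop :=
  exists (p : program) (c : nat),
    forall (n : nat) (G : pooling n (m n)) (y : results (m n)),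
      (forall j, y j <= n) ->
      exists (t : nat) (s : memory),
        [/\ exec p (input (k n) G y) t s,
            t <= c * n ^ c + c
          & outputs s (D n G y)].

(* Main.v *)
(* The pools come in [T] groups of [M + 1], and group [g] only touches the
   first [(g + 1) h] items: its first pool contains all of them, the others
   are independent uniformly random subsets of them. Items are decoded one by
   one, so when item [j] is treated the earlier labels have been subtracted
   and the full pool of group [g] reveals the number [K_g] of ones left in [j,
   (g + 1) h). If [x] is the 0/1 membership of a random pool and [r] its
   residual count, then [(2 x_j - 1) (2 r - K_g)] equals [sigma_j] plus a sum
   of at most [K_g] independent random signs. Averaging these scores with the
   inverse variances [1 / K_g] as weights, of sum [S], the deviation of the
   mean from [sigma_j] has Gaussian tails of variance [1 / S]. As [K_g] grows
   linearly in the distance of [g] from the group of [j], the sum [S] is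
   harmonic, about [(m / k) ln k = (m / k) theta ln n]. A threshold [alpha]
   errs on a zero with probability [exp (- alpha^2 S / 2)] and on a one with
   probability [exp (- (1 - alpha)^2 S / 2)]. The union bound over [n] zeros
   and [k = n^theta] ones requires [S > 2 (1 + sqrt theta)^2 ln n] at [alpha =
   1 / (1 + sqrt theta)], that is [m > 2 (1 + sqrt theta)^2 / theta k], the
   bound of the theorem. *)
Require Import Defs.
From mathcomp Require Import all_boot all_order all_algebra.
From mathcomp Require Import all_fingroup.
From mathcomp Require Import all_classical all_reals all_analysis.
From mathcomp Require Import zify ring lra.
Import Order.TTheory GRing.Theory Num.Theory.
Import numFieldNormedType.Exports.

Set Implicit Arguments.
Unset Strict Implicit.
Unset Printing Implicit Defensive.

Local Open Scope nat_scope.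

(** * Total correctness of programs, with time bounds *)

Definition runs (p : program) (s : memory) (t : nat) (Q : memory -> Prop) : Prop :=
  exists t' s', [/\ exec p s t' s', t' <= t & Q s'].

Lemma runsW p s t u (P Q : memory -> Prop) :
  runs p s t P -> t <= u -> (forall s', P s' -> Q s') -> runs p s u Q.
Proof.
by move=> [t' [s' [ex le_t Ps]]] tu PQ; exists t', s'; split => //;
  [exact: leq_trans tu | exact: PQ].
Qed.

Lemma runs_seq p q s t u (P Q : memory -> Prop) :
  runs p s t P -> (forall s', P s' -> runs q s' u Q) -> runs (Seq p q) s (t + u) Q.
Proof.
move=> [t' [s1 [ex1 le1 P1]]] /(_ _ P1) [u' [s2 [ex2 le2 Q2]]].
by exists (t' + u'), s2; split => //; [exact: ExecSeq ex1 ex2 | exact: leq_add].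
Qed.

Lemma runs_if e p q s t (Q : memory -> Prop) :
  (Defs.eval s e != 0 -> runs p s t Q) -> (Defs.eval s e = 0 -> runs q s t Q) ->
  runs (If e p q) s (cost e + t).+1 Q.
Proof.
move=> Hp Hq; have [e0|e_neq0] := eqVneq (Defs.eval s e) 0.
  have [t' [s' [ex le_t Qs]]] := Hq e0; exists (cost e + t').+1, s'.
  by split => //; [exact: ExecIfFalse | rewrite ltnS leq_add2l].
have [t' [s' [ex le_t Qs]]] := Hp e_neq0; exists (cost e + t').+1, s'.
by split => //; [exact: ExecIfTrue | rewrite ltnS leq_add2l].
Qed.

(** The invariant carries the iteration number and thereby determines the guard: exactly [N] rounds
    are made, and the last, failing test accounts for the final [(cost e).+1]. *)
Lemma runs_while (I : nat -> memory -> Prop) N e p s t :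
  (forall i s', i < N -> I i s' -> Defs.eval s' e != 0 /\ runs p s' t (I i.+1)) ->
  (forall s', I N s' -> Defs.eval s' e = 0) ->
  I 0 s -> runs (While e p) s (N * (cost e + t).+1 + (cost e).+1) (I N).
Proof.
move=> Istep Iend.
suff loop d i s' : i + d = N -> I i s' ->
    runs (While e p) s' (d * (cost e + t).+1 + (cost e).+1) (I N).
  by move=> I0; apply: (loop N 0).
elim: d i s' => [|d IHd] i s' iN Ii.
  have eqi : i = N by lia.
  rewrite eqi in Ii; exists (cost e).+1, s'; split => //.
  by apply: ExecWhileFalse; apply: Iend.
have [|e_neq0 [t1 [s1 [ex1 le1 I1]]]] := Istep i s' _ Ii; first by lia.
have [|u [s2 [ex2 le2 I2]]] := IHd i.+1 s1 _ I1; first by lia.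
exists (cost e + t1 + u).+1, s2; split => //; last by lia.
exact: ExecWhileTrue ex1 ex2.
Qed.

Fixpoint loop_free (p : program) : bool :=
  match p with
  | Skip | Write _ _ _ => true
  | Seq p q | If _ p q => loop_free p && loop_free q
  | While _ _ => false
  end.

(** Symbolic execution: correctness of loop-free code becomes a computation. The value on [While] is
    a default that [loop_free] excludes. *)
Fixpoint final_memory (p : program) (s : memory) : memory :=
  match p with
  | Write a i v => update s a (Defs.eval s i) (Defs.eval s v)
  | Seq p q => final_memory q (final_memory p s)
  | If e p q => if Defs.eval s e == 0 then final_memory q s else final_memory p s
  | _ => s
  end.

(** The costs of both branches are added, which gives an upper bound that does not depend on the
    memory. *)
Fixpoint duration (p : program) : nat :=
  match p with
  | Write _ i v => (cost i + cost v).+1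
  | Seq p q => duration p + duration q
  | If e p q => (cost e + (duration p + duration q)).+1
  | _ => 1
  end.

Lemma runs_loop_free p s : loop_free p ->
  runs p s (duration p) (fun s' => s' = final_memory p s).
Proof.
elim: p s => [|a i v|p IHp q IHq|e p IHp q IHq|//] s.
- by exists 1, s; split => //; constructor.
- by move=> _; exists (cost i + cost v).+1; eexists; split; first exact: ExecWrite.
- move=> /= /andP[/IHp rp /IHq rq]; apply: runs_seq (rp s) _ => s' ->.
  exact: rq.
move=> /= /andP[/IHp rp /IHq rq]; apply: runs_if.
  move=> /negbTE ->; apply: runsW (rp s) _ _ => //; exact: leq_addr.
by move=> ->; apply: runsW (rq s) _ _ => //; exact: leq_addl.
Qed.

(** * The greedy decoder, as a function and as a program *)

(** The machine does not multiply, but [b] is fixed with the program and can be unrolled into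
    additions. *)
Definition scale_expr (b : nat) (e : expr) : expr := iter b (Add e) (Const 0).

Lemma eval_scale_expr b e s : Defs.eval s (scale_expr b e) = b * Defs.eval s e.
Proof. by elim: b => //= b ->; rewrite mulSn. Qed.

(* [n %/ K.+1] stands for the inverse variance [1 / K], scaled by [n].  The
   comparison [b * Z > A * mu] of the score with [A / b] times its mean for label
   one is split into two sums of naturals. *)
Definition pos_vote (b : nat) (x : bool) (r K : nat) : nat :=
  b * (if x then r + r else K).

Definition neg_vote (A b : nat) (x : bool) (r K : nat) : nat :=
  b * (if x then K else r + r) + A.

(** Pools [g * M.+1] to [g * M.+1 + M] form group [g], and the first of them is its full pool. Hence
    [r (g * M.+1)] is [K_g], and the factor [X (g * M.+1) j] drops the groups that do not reach item
    [j]. *)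
Definition vote_count (M n T : nat) (X : nat -> nat -> bool) (r : nat -> nat) (j : nat)
    (vote : bool -> nat -> nat -> nat) : nat :=
  \sum_(g < T) X (g * M.+1) j * \sum_(c < M)
    (n %/ (r (g * M.+1)).+1)
    * vote (X (g * M.+1 + c.+1) j) (r (g * M.+1 + c.+1)) (r (g * M.+1)).

Definition decide (A b M n T : nat) (X : nat -> nat -> bool) (r : nat -> nat)
    (j : nat) : bool :=
  vote_count M n T X r j (neg_vote A b) < vote_count M n T X r j (pos_vote b).

(** Truncation of the subtraction can only matter after a wrong decision, a case that the analysis
    counts as failure. *)
Fixpoint residual (A b M n T : nat) (X : nat -> nat -> bool) (y : nat -> nat)
    (j : nat) : nat -> nat :=
  if j is i.+1 then
    let r := residual A b M n T X y i in
    fun a => r a - (X a i && decide A b M n T X r i)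
  else y.

Definition greedy (A b M n T : nat) (X : nat -> nat -> bool) (y : nat -> nat)
    (j : nat) : bool :=
  decide A b M n T X (residual A b M n T X y j) j.

Definition cell (i : nat) : expr := Read 5 (Const i).
Definition set_cell (i : nat) (e : expr) : program := Write 5 (Const i) e.
Definition n_items : expr := Read 0 (Const 0).
Definition n_pools : expr := Read 0 (Const 2).

(* Cells of array 5: 0 item, 1 votes for label one, 2 votes against it,
   3 pool, 4 address of the entry (pool, item) in array 2, 5 full pool of the
   group, 6 pools left in the group, 7 remainder of the division, 8 decision,
   9 is the item in the full pool, 10 and 11 votes of the current pool. *)
Definition advance : program :=
  Seq (set_cell 3 (Add (cell 3) (Const 1))) (set_cell 4 (Add (cell 4) n_items)).

(* The quotient [n %/ K.+1] is the number of iterations of [cast_votes]. *)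
Definition cast_votes : program :=
  Seq (set_cell 7 (Defs.Sub (cell 7) (Add (Read 1 (cell 5)) (Const 1))))
  (Seq (set_cell 1 (Add (cell 1) (cell 10)))
       (set_cell 2 (Add (cell 2) (cell 11)))).

Definition ballot (A b : nat) : program :=
  Seq (If (Read 2 (cell 4))
        (Seq (set_cell 10 (scale_expr b (Add (Read 1 (cell 3)) (Read 1 (cell 3)))))
             (set_cell 11 (Add (scale_expr b (Read 1 (cell 5))) (Const A))))
        (Seq (set_cell 10 (scale_expr b (Read 1 (cell 5))))
             (set_cell 11 (Add (scale_expr b (Add (Read 1 (cell 3)) (Read 1 (cell 3))))
                              (Const A)))))
      (set_cell 7 n_items).

Definition pool_step (A b : nat) : program :=
  Seq (If (cell 9)
         (Seq (ballot A b) (While (Defs.Sub (cell 7) (Read 1 (cell 5))) cast_votes)) Skip)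
      (Seq advance (set_cell 6 (Defs.Sub (cell 6) (Const 1)))).

Definition open_group (M : nat) : program :=
  Seq (set_cell 5 (cell 3)) (Seq (set_cell 9 (Read 2 (cell 4)))
    (Seq advance (set_cell 6 (Const M)))).

Definition group_step (A b M : nat) : program :=
  Seq (open_group M) (While (cell 6) (pool_step A b)).

Definition rewind : program := Seq (set_cell 3 (Const 0)) (set_cell 4 (cell 0)).

Definition peel : program :=
  Seq (If (Read 2 (cell 4)) (Write 1 (cell 3) (Defs.Sub (Read 1 (cell 3)) (cell 8))) Skip)
      advance.

Definition verdict : program :=
  Seq (If (Defs.Sub (cell 1) (cell 2)) (set_cell 8 (Const 1)) (set_cell 8 (Const 0)))
      (Seq (Write 3 (cell 0) (cell 8)) rewind).

Definition item_step (A b M : nat) : program :=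
  Seq (Seq (set_cell 1 (Const 0)) (Seq (set_cell 2 (Const 0)) rewind))
  (Seq (While (Defs.Sub n_pools (cell 3)) (group_step A b M))
  (Seq verdict
  (Seq (While (Defs.Sub n_pools (cell 3)) peel)
       (set_cell 0 (Add (cell 0) (Const 1)))))).

Definition greedy_program (A b M : nat) : program :=
  While (Defs.Sub n_items (cell 0)) (item_step A b M).

(** * Correctness and running time of the program *)

(** The frame condition of a program fragment, [L] being the work cells that it may touch. *)
Definition agree (L : seq nat) (s s' : memory) : Prop :=
  forall a i, (a != 5) || (i \notin L) -> s' a i = s a i.

Lemma agree_trans L s1 s2 s3 : agree L s1 s2 -> agree L s2 s3 -> agree L s1 s3.
Proof. by move=> h12 h23 a i ai; rewrite h23 ?h12. Qed.

Lemma agreeW L L' s s' : {subset L <= L'} -> agree L s s' -> agree L' s s'.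
Proof.
move=> LL' h a i ai; apply: h; apply: contraTT ai.
by rewrite !negb_or !negbK => /andP[-> /LL' ->].
Qed.

Lemma agree_update (L : seq nat) s s' i v :
  i \in L -> agree L s s' -> agree L s (update s' 5 i v).
Proof.
move=> iL h a k ak; rewrite /update; case: ifP => [/andP[/eqP ai /eqP ki]|_]; last exact: h.
by move: ak; rewrite ki ai iL.
Qed.

(** Division by repeated subtraction: the guard holds while cell 7 is at least [K.+1], that is for
    [n %/ K.+1] rounds, and each round adds one copy of the current votes. This weights the votes
    without a product. A round costs less than 40 units. *)
Lemma runs_division n s :
  s 5 7 = n ->
  runs (While (Defs.Sub (cell 7) (Read 1 (cell 5))) cast_votes) s (40 * n.+1)
    (fun s' => [/\ agree [:: 1; 2; 7] s s',
       s' 5 1 = s 5 1 + n %/ (s 1 (s 5 5)).+1 * s 5 10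
     & s' 5 2 = s 5 2 + n %/ (s 1 (s 5 5)).+1 * s 5 11]).
Proof.
move=> s7; set K := s 1 _; set N := n %/ K.+1.
pose I i s' := [/\ agree [:: 1; 2; 7] s s', s' 5 7 = n - i * K.+1,
  s' 5 1 = s 5 1 + i * s 5 10 & s' 5 2 = s 5 2 + i * s 5 11].
have leN : N * K.+1 <= n by rewrite leq_divM.
have ltN : n < N.+1 * K.+1 by rewrite ltn_ceil.
eapply runsW; first (eapply (@runs_while I N _ _ _ (duration cast_votes))).
- move=> i s' iN [ag h7 h1 h2] /=.
  have h5 : s' 1 (s' 5 5) = K by rewrite !ag.
  split.
    have : i.+1 * K.+1 <= N * K.+1 by rewrite leq_mul2r iN orbT.
    by rewrite h5 h7 mulSn; lia.
  eapply runsW; [exact: runs_loop_free | by [] | move=> _ ->].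
  split=> /=.
  + by do 3 apply: agree_update => //.
  + by rewrite /update /= h5 h7 mulSn; lia.
  + by rewrite /update /= h1 !ag // mulSn; lia.
  + by rewrite /update /= h2 !ag // mulSn; lia.
- move=> s' [ag h7 _ _] /=.
  have h5 : s' 1 (s' 5 5) = K by rewrite !ag.
  by rewrite h5 h7; move: ltN; rewrite mulSn; lia.
- by split => //; rewrite mul0n ?subn0 ?addn0.
- have : N <= n by rewrite leq_div.
  by rewrite /=; lia.
- by move=> s' [].
Qed.

Definition div_cost (n : nat) : nat := 40 * n.+1.

Definition pool_cost (A b n : nat) : nat :=
  3 + duration (ballot A b) + div_cost n + duration advance + 20.

Lemma runs_pool_step A b s :
  let n := s 0 0 in let p := s 5 4 in
  let x := s 2 p != 0 in let r := s 1 (s 5 3) in let K := s 1 (s 5 5) in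
  let w := (s 5 9 != 0) * (n %/ K.+1) in
  runs (pool_step A b) s (pool_cost A b n)
    (fun s' => [/\ agree [:: 1; 2; 3; 4; 6; 7; 10; 11] s s',
       s' 5 3 = (s 5 3).+1, s' 5 4 = p + n, s' 5 6 = (s 5 6).-1
     & s' 5 1 = s 5 1 + w * pos_vote b x r K /\
       s' 5 2 = s 5 2 + w * neg_vote A b x r K]).
Proof.
move=> n p x r K w.
have step2 s1 : agree [:: 1; 2; 7; 10; 11] s s1 ->
    s1 5 1 = s 5 1 + w * pos_vote b x r K ->
    s1 5 2 = s 5 2 + w * neg_vote A b x r K ->
    runs (Seq advance (set_cell 6 (Defs.Sub (cell 6) (Const 1)))) s1
      (duration advance + 6)
    (fun s' => [/\ agree [:: 1; 2; 3; 4; 6; 7; 10; 11] s s',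
       s' 5 3 = (s 5 3).+1, s' 5 4 = p + n, s' 5 6 = (s 5 6).-1
     & s' 5 1 = s 5 1 + w * pos_vote b x r K /\
       s' 5 2 = s 5 2 + w * neg_vote A b x r K]).
  move=> ag h1 h2; eapply runsW; [exact: runs_loop_free | by [] | move=> _ ->].
  split=> /=.
  - do 3 apply: agree_update => //; apply: agreeW ag => i.
    by rewrite !inE; do ?[case/orP]; move=> /eqP->.
  - by rewrite /update /= ag // addn1.
  - by rewrite /update /= !ag.
  - by rewrite /update /= ag // subn1.
  - by rewrite /update /=.
pose Q s1 := [/\ agree [:: 1; 2; 7; 10; 11] s s1,
    s1 5 1 = s 5 1 + w * pos_vote b x r K
  & s1 5 2 = s 5 2 + w * neg_vote A b x r K].
eapply runsW; first eapply (@runs_seq _ _ _ _ _ Q); last (by move=> s3 h3; exact: h3).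
- eapply (@runs_if _ _ _ _ (duration (ballot A b) + div_cost n)) => /= s9; last first.
    eapply runsW; [exact: runs_loop_free | | move=> _ ->].
      by rewrite /= addn_gt0 orbT.
    by split; rewrite /w ?s9 ?addn0.
  eapply runs_seq; first exact: (runs_loop_free _ (_ : loop_free (ballot A b))).
  move=> _ ->.
  have ws9 : w = n %/ K.+1 by rewrite /w s9 mul1n.
  set s1 := final_memory _ _.
  have [ag s17 s110 s111] : [/\ agree [:: 7; 10; 11] s s1, s1 5 7 = n,
      s1 5 10 = pos_vote b x r K & s1 5 11 = neg_vote A b x r K].
    rewrite /s1 /= -/p; case: (eqVneq (s 2 p) 0) => sp /=.
      split; last 3 first.
      + by [].
      + by rewrite /update /= eval_scale_expr /pos_vote /x sp.
      + by rewrite /update /= eval_scale_expr /neg_vote /x sp.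
      by do 3 apply: agree_update => //.
    split; last 3 first.
    + by [].
    + by rewrite /update /= eval_scale_expr /pos_vote /x sp.
    + by rewrite /update /= eval_scale_expr /neg_vote /x sp.
    by do 3 apply: agree_update => //.
  eapply runsW; [exact: (runs_division s17) | by [] | move=> s2 [ag2 e1 e2]].
  split.
  + apply: agree_trans; [apply: agreeW ag | apply: agreeW ag2];
    by move=> i; rewrite !inE; do ?[case/orP]; move=> /eqP->.
  + by rewrite e1 s110 !ag // ws9.
  + by rewrite e2 s111 !ag // ws9.
- by move=> s1 [ag h1 h2]; apply: step2.
- by rewrite /pool_cost /=; lia.
Qed.

Definition stores n m (X : nat -> nat -> bool) (r : nat -> nat) (s : memory) : Prop :=
  [/\ s 0 0 = n, s 0 2 = m,
      forall a i, a < m -> i < n -> s 2 (a * n + i) = X a i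
    & forall a, a < m -> s 1 a = r a].

Lemma stores_agree L n m X r s s' :
  agree L s s' -> stores n m X r s -> stores n m X r s'.
Proof.
move=> ag [h0 h2 hX hr]; split; rewrite ?ag// => a i.
  by move=> am iN; rewrite ag ?hX.
by rewrite ag // hr.
Qed.

Definition group_cells : seq nat := [:: 1; 2; 3; 4; 5; 6; 7; 9; 10; 11].

Definition group_votes (M n : nat) (X : nat -> nat -> bool) (r : nat -> nat) (j : nat)
    (vote : bool -> nat -> nat -> nat) (g c : nat) : nat :=
  X (g * M.+1) j * \sum_(i < c) (n %/ (r (g * M.+1)).+1)
    * vote (X (g * M.+1 + i.+1) j) (r (g * M.+1 + i.+1)) (r (g * M.+1)).

Lemma group_votesS M n X r j vote g c :
  group_votes M n X r j vote g c.+1 = group_votes M n X r j vote g c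
    + X (g * M.+1) j * (n %/ (r (g * M.+1)).+1)
    * vote (X (g * M.+1 + c.+1) j) (r (g * M.+1 + c.+1)) (r (g * M.+1)).
Proof. by rewrite /group_votes big_ord_recr /= mulnDr mulnA. Qed.

Definition group_cost (A b M n : nat) : nat :=
  duration (open_group M) + (M * (2 + pool_cost A b n).+1 + 3).

Lemma runs_group_step A b M n m T X r s g j :
  m = T * M.+1 -> g < T -> j < n -> stores n m X r s ->
  s 5 0 = j -> s 5 3 = g * M.+1 -> s 5 4 = g * M.+1 * n + j ->
  runs (group_step A b M) s (group_cost A b M n)
    (fun s' => [/\ agree group_cells s s',
       s' 5 3 = g.+1 * M.+1, s' 5 4 = g.+1 * M.+1 * n + j,
       s' 5 1 = s 5 1 + group_votes M n X r j (pos_vote b) g M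
     & s' 5 2 = s 5 2 + group_votes M n X r j (neg_vote A b) g M]).
Proof.
move=> mE gT jn hs s0 s3 s4.
have am c : c <= M -> g * M.+1 + c < m.
  move=> cM; rewrite mE; apply: (@leq_trans (g.+1 * M.+1)).
    by rewrite mulSn; lia.
  by rewrite leq_mul2r gT orbT.
have am0 : g * M.+1 < m by have := am 0 isT; rewrite addn0.
have [hn hm hX hr] := hs.
pose I c s' := [/\ agree group_cells s s',
  [/\ s' 5 3 = g * M.+1 + c.+1, s' 5 4 = (g * M.+1 + c.+1) * n + j,
      s' 5 5 = g * M.+1, s' 5 6 = M - c & s' 5 9 = X (g * M.+1) j],
  s' 5 1 = s 5 1 + group_votes M n X r j (pos_vote b) g c
  & s' 5 2 = s 5 2 + group_votes M n X r j (neg_vote A b) g c].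
have gv0 vote : group_votes M n X r j vote g 0 = 0.
  by rewrite /group_votes big_ord0 muln0.
eapply runs_seq; first exact: runs_loop_free.
move=> _ ->; set s1 := final_memory _ _.
have I0 : I 0 s1.
  rewrite /s1 /=; split.
  - by do 5 apply: agree_update => //.
  - split; rewrite /update /= ?s3 ?addn1 ?subn0 //.
      by rewrite s4 hn mulSn; lia.
    by rewrite s4 hX.
  - by rewrite gv0 addn0.
  - by rewrite gv0 addn0.
eapply runsW; first eapply (@runs_while I M _ _ _ (pool_cost A b n)).
- move=> c s2 cM [ag [h3 h4 h5 h6 h9] h1 h2]; split.
    by rewrite /= h6 -lt0n subn_gt0.
  have h00 : s2 0 0 = n by rewrite ag.
  have hX2 : s2 2 ((g * M.+1 + c.+1) * n + j) = X (g * M.+1 + c.+1) j.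
    by rewrite ag // hX //; apply: am.
  have hK : s2 1 (g * M.+1) = r (g * M.+1) by rewrite ag // hr.
  have hR : s2 1 (g * M.+1 + c.+1) = r (g * M.+1 + c.+1).
    by rewrite ag // hr //; apply: am.
  have := runs_pool_step A b s2.
  rewrite /= h00 h3 h4 h5 h6 h9 hX2 hK hR !eqb0 !negbK => rp.
  eapply runsW; [exact: rp | by [] | move=> s3' [ag3 k3 k4 k6 [k1 k2]]].
  split.
  + apply: agree_trans ag _; apply: agreeW ag3 => i.
    by rewrite !inE; do ?[case/orP]; move=> /eqP->.
  + split; rewrite ?k3 ?k4 ?k6 ?addnS ?subnS //.
    * by rewrite [in RHS]mulSn; lia.
    * by rewrite ag3.
    * by rewrite ag3.
  + by rewrite k1 h1 group_votesS addnA.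
  + by rewrite k2 h2 group_votesS addnA.
- by move=> s2 [_ [_ _ _ h6 _] _ _]; rewrite /= h6 subnn.
- exact: I0.
- by [].
move=> s2 [ag [h3 h4 _ _ _] h1 h2]; split => //.
- by rewrite h3 mulSn; lia.
- by rewrite h4 mulSn; congr (_ * n + j); lia.
Qed.

Lemma runs_vote_count A b M n m T X r s j :
  m = T * M.+1 -> j < n -> stores n m X r s ->
  s 5 0 = j -> s 5 1 = 0 -> s 5 2 = 0 -> s 5 3 = 0 -> s 5 4 = j ->
  runs (While (Defs.Sub n_pools (cell 3)) (group_step A b M)) s
    (T * (5 + group_cost A b M n).+1 + 6)
    (fun s' => [/\ agree group_cells s s',
       s' 5 1 = vote_count M n T X r j (pos_vote b)
     & s' 5 2 = vote_count M n T X r j (neg_vote A b)]).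
Proof.
move=> mE jn hs s0 s1 s2 s3 s4.
pose I g s' := [/\ agree group_cells s s', s' 5 3 = g * M.+1,
  s' 5 4 = g * M.+1 * n + j,
  s' 5 1 = vote_count M n g X r j (pos_vote b)
  & s' 5 2 = vote_count M n g X r j (neg_vote A b)].
have hm s' : agree group_cells s s' -> s' 0 2 = m by case: hs => _ <- _ _ ->.
eapply runsW; first eapply (@runs_while I T _ _ _ (group_cost A b M n)).
- move=> g s' gT [ag h3 h4 h1 h2]; split.
    rewrite /= hm // h3 mE; have : g.+1 * M.+1 <= T * M.+1 by rewrite leq_mul2r gT orbT.
    by rewrite mulSn; lia.
  eapply runsW.
  + apply: (runs_group_step A b (T := T) mE gT jn (stores_agree ag hs)) => //.
    by rewrite ag.
  + by [].
  + move=> s'' [ag' k3 k4 k1 k2]; split => //.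
    * exact: agree_trans ag ag'.
    * by rewrite k1 h1 /vote_count big_ord_recr.
    * by rewrite k2 h2 /vote_count big_ord_recr.
- by move=> s' [ag h3 _ _ _]; rewrite /= hm // h3 mE subnn.
- by split => //; rewrite ?mul0n ?s3 ?s4 // /vote_count big_ord0 ?s1 ?s2.
- by rewrite /=; lia.
- by move=> s' [].
Qed.

Lemma runs_peel n m X r s j (x : bool) :
  j < n -> stores n m X r s ->
  s 5 3 = 0 -> s 5 4 = j -> s 5 8 = x ->
  runs (While (Defs.Sub n_pools (cell 3)) peel) s
    (m * (5 + duration peel).+1 + 6)
    (fun s' => [/\ stores n m X (fun a => r a - (X a j && x)) s',
       s' 3 =1 s 3 & s' 5 0 = s 5 0]).
Proof.
move=> jn [hn hm hX hr] s3 s4 s8.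
pose r' c a := if a < c then r a - (X a j && x) else r a.
pose I c s' := [/\ stores n m X (r' c) s', s' 3 =1 s 3, s' 5 0 = s 5 0,
  s' 5 8 = x & s' 5 3 = c /\ s' 5 4 = c * n + j].
eapply runsW; first eapply (@runs_while I m _ _ _ (duration peel)).
- move=> c s' cm [[kn km kX kr] k3 k0 k8 [c3 c4]]; split.
    by rewrite /= km c3 -lt0n subn_gt0.
  eapply runsW; [exact: runs_loop_free | by [] | move=> _ ->].
  rewrite /= c3 c4 kX //; case: ifP => Xc; split.
  + split=> // a am; rewrite /update /= kr // /r' ltnS.
    by case: ltngtP => // ->; move: Xc; case: (X c j) => //=; rewrite subn0.
  + by move=> i; rewrite /update /= k3.
  + by rewrite /update /= k0.
  + by rewrite /update /= k8.
  + by rewrite /update /= ?c3 ?c4 kn addn1 mulSn; split => //; lia.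
  + split=> // a am; rewrite /update /= ?c3 ?c4 /= k8 !kr // /r' ltnS.
    have [->|] := eqVneq a c; first by rewrite ltnn leqnn; move: Xc; case: (X c j).
    by case: ltngtP.
  + by move=> i; rewrite /update /= k3.
  + by rewrite /update /= k0.
  + by rewrite /update /= k8.
  + by rewrite /update /= ?c3 ?c4 kn addn1 mulSn; split => //; lia.
- by move=> s' [[_ km _ _] _ _ _ [c3 _]]; rewrite /= km c3 subnn.
- by split.
- by [].
- move=> s' [[kn km kX kr] k3 k0 _ _]; split => //; split => // a am.
  by rewrite kr // /r' am.
Qed.

Definition item_cost (A b M T n m : nat) : nat :=
  100 + (T * (5 + group_cost A b M n).+1 + 6) + (m * (5 + duration peel).+1 + 6).

Lemma runs_item_step A b M n m T X r s j :
  m = T * M.+1 -> j < n -> stores n m X r s -> s 5 0 = j ->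
  runs (item_step A b M) s (item_cost A b M T n m)
    (fun s' => [/\ stores n m X (fun a => r a - (X a j && decide A b M n T X r j)) s',
       s' 5 0 = j.+1
     & forall i, s' 3 i = if i == j then decide A b M n T X r j : nat else s 3 i]).
Proof.
move=> mE jn hs s0; set d := decide _ _ _ _ _ _ _ _.
set Q := (X in runs _ _ _ X).
eapply (@runsW _ _ _ _ Q).
- eapply runs_seq; first exact: runs_loop_free.
  move=> _ ->; set s1 := final_memory _ _.
  have ag1 : agree group_cells s s1 by do 4 apply: agree_update => //.
  eapply runs_seq.
    by apply: (runs_vote_count A b (T := T) mE jn (stores_agree ag1 hs)).
  move=> s2 [ag2 h1 h2]; have ag := agree_trans ag1 ag2.
  eapply runs_seq; first exact: runs_loop_free.
  move=> _ ->; set s3 := final_memory _ _.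
  have [e0 e3 e4 [e8 e3j] hs3] : [/\ s3 5 0 = j, s3 5 3 = 0, s3 5 4 = j,
      s3 5 8 = d /\ forall i, s3 3 i = (if i == j then d : nat else s 3 i)
    & stores n m X r s3].
    rewrite /s3 /= h1 h2 subn_eq0 leqNgt.
    have -> : (vote_count M n T X r j (neg_vote A b) <
      vote_count M n T X r j (pos_vote b)) = d by [].
    have hs2 := stores_agree ag hs.
    clear Q; case: d; split => //=; rewrite /update /= ?ag //;
      by split => // i; rewrite ?ag ?s0.
  eapply runs_seq; first exact: (runs_peel jn hs3 e3 e4 e8).
  move=> s4 [k1 k2 k3].
  eapply runsW; [exact: runs_loop_free | by [] | move=> _ ->].
  by split => [||i]; [exact: k1 | rewrite /= /update /= k3 e0 addn1
    | rewrite /= /update /= k2 e3j].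
- by rewrite /item_cost /=; lia.
- by [].
Qed.

Lemma runs_greedy_program A b M n m T X y s :
  m = T * M.+1 -> stores n m X y s -> s 5 0 = 0 ->
  runs (greedy_program A b M) s (n * (5 + item_cost A b M T n m).+1 + 6)
    (fun s' => forall i, i < n -> s' 3 i = greedy A b M n T X y i).
Proof.
move=> mE hs s0.
pose I j s' := [/\ stores n m X (residual A b M n T X y j) s', s' 5 0 = j
  & forall i, i < j -> s' 3 i = greedy A b M n T X y i].
eapply runsW; first eapply (@runs_while I n _ _ _ (item_cost A b M T n m)).
- move=> j s' jn [hs' h0 h3]; split.
    by case: hs' => hn _ _ _; rewrite /= hn h0 -lt0n subn_gt0.
  eapply runsW; [exact: (runs_item_step A b mE jn hs' h0) | by [] |].
  move=> s2 [k1 k0 k3]; split => // i; rewrite k3 ltnS leq_eqVlt.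
  by case: eqP => [->|_] //= /h3.
- by move=> s' [[hn _ _ _] h0 _]; rewrite /= hn h0 subnn.
- by split.
- by [].
- by move=> s' [].
Qed.

(** * The decoder on the actual input, in polynomial time *)

Definition in_pool n m (G : pooling n m) (a i : nat) : bool :=
  [exists p : 'I_m, exists q : 'I_n, [&& p == a :> nat, q == i :> nat & q \in G p]].

Lemma in_poolE n m (G : pooling n m) (a : 'I_m) (i : 'I_n) :
  in_pool G a i = (i \in G a).
Proof.
apply/existsP/idP => [[p /existsP[q /and3P[/eqP/val_inj-> /eqP/val_inj->]]]|iG] //.
by exists a; apply/existsP; exists i; rewrite !eqxx.
Qed.

Definition result m (y : results m) (a : nat) : nat := oapp y 0 (insub a).

Definition greedy_decoder (A b M n m T : nat) : decoder n m :=
  fun G y => [ffun i : 'I_n => greedy A b M n T (in_pool G) (result y) i].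

Lemma stores_input n m k (G : pooling n m) (y : results m) :
  stores n m (in_pool G) (result y) (input k G y).
Proof.
split => // a i am iN /=; congr nat_of_bool.
apply: eq_existsb => p; apply: eq_existsb => q.
rewrite andbA; congr andb; apply/eqP/andP => [|[/eqP-> /eqP->]//].
(* Division by [n] recovers the row from the address, because columns are below [n]. *)
move=> e; have pa : p = a :> nat.
  have := congr1 (divn^~ n) e.
  by rewrite /= !divnMDl ?(leq_ltn_trans (leq0n i)) // !divn_small // !addn0 => ->.
by move: e; rewrite pa => /addnI ->.
Qed.

Lemma item_cost_bound A b M : exists c, forall T n m, T <= m ->
  item_cost A b M T n m <= c * n.+1 * m.+1.
Proof.
pose c1 := 60 + duration (ballot A b) + duration advance + 100.
pose c2 := duration (open_group M) + M * (3 + c1) + 3 + 10.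
exists (200 + c2 + duration peel) => T n m Tm.
have h1 : pool_cost A b n <= c1 * n.+1 by rewrite /pool_cost /div_cost /c1; nia.
have h2 : 6 + group_cost A b M n <= c2 * n.+1.
  have : M * (2 + pool_cost A b n).+1 <= M * ((3 + c1) * n.+1) by rewrite leq_mul2l; nia.
  by rewrite /group_cost /c2; nia.
have h3 : T * (6 + group_cost A b M n) <= m * (c2 * n.+1) by rewrite leq_mul.
by rewrite /item_cost -addSn; nia.
Qed.

Lemma poly_time_greedy A b M C (k T m : nat -> nat) :
  (forall n, m n = T n * M.+1) -> (forall n, m n <= C * n) ->
  poly_time k (fun n => greedy_decoder A b M (m := m n) (T n)).
Proof.
move=> mE mC; have [c0 hc0] := item_cost_bound A b M.
pose c1 := 6 + c0 * C.+1; exists (greedy_program A b M), (8 * c1 + 3).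
(* As [m] is linear in [n], the time is at most [c1 * n.+1 ^ 3], hence at most [8 * c1 * n ^ 3] for
   positive [n]. One constant that is at least [8 * c1] and at least the exponent 3 serves; its
   additive occurrence covers [n = 0]. *)
move=> n G y _.
have [t [s [ex le_t out]]] := runs_greedy_program A b (mE n) (stores_input (k n) G y) erefl.
exists t, s; split => //; last by move=> i; rewrite out // ffunE.
have Tm : T n <= m n by rewrite mE leq_pmulr.
apply: leq_trans le_t _.
have h1 : item_cost A b M (T n) n (m n) <= c0 * C.+1 * n.+1 ^ 2.
  apply: leq_trans (hc0 _ _ _ Tm) _; have := mC n.
  rewrite expnS expn1; nia.
have h2 : n * (5 + item_cost A b M (T n) n (m n)).+1 + 6 <= c1 * n.+1 ^ 3.
  by rewrite /c1 !expnS expn0; move: h1; rewrite !expnS expn0; nia.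
apply: leq_trans h2 _; case: n {G y ex out Tm h1} => [|n'].
  by rewrite exp1n muln1; lia.
set n := n'.+1; apply: leq_trans (leq_addr _ _).
apply: (@leq_trans (c1 * (8 * n ^ 3))).
  by rewrite leq_mul2l -[8]/(2 ^ 3) -expnMn leq_exp2r // /n; apply/orP; right; lia.
rewrite mulnCA mulnA leq_mul ?leq_addr // leq_pexp2l //; lia.
Qed.

(** * Exponential moments of random signs *)

Local Open Scope ring_scope.

Lemma derive_nonneg_ge (R : realType) (f df : R -> R) (x : R) :
  (forall y : R, is_derive y (1 : R) f (df y)) ->
  (forall y, 0 <= y -> 0 <= df y) -> 0 <= x -> f 0 <= f x.
Proof.
move=> fdf df_ge0 x_ge0.
have [|c] := @MVT_segment R f df 0 x x_ge0 (fun y _ => fdf y).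
  apply: continuous_subspaceT => y; apply: differentiable_continuous.
  by apply/derivable1_diffP; apply: ex_derive.
rewrite in_itv /= => /andP[c_ge0 _] e.
by rewrite -subr_ge0 e subr0 mulr_ge0 // df_ge0.
Qed.

(** Up to a factor 2, the difference [y cosh y - sinh y] vanishes at 0 and has derivative
    [y sinh y]. *)
Lemma sinh_le_mul_cosh (R : realType) (x : R) : 0 <= x ->
  expR x - expR (- x) <= x * (expR x + expR (- x)).
Proof.
move=> x_ge0; rewrite -subr_ge0.
pose f (y : R) : R := y * (expR y + expR (- y)) - (expR y - expR (- y)).
have /= := @derive_nonneg_ge R f (fun y => y * (expR y - expR (- y))) x _ _ x_ge0.
rewrite /f mul0r oppr0 !subrr; apply => y.
- apply: is_derive_eq; rewrite /GRing.scale /=; ring.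
- by move=> y_ge0; rewrite mulr_ge0 // subr_ge0 ler_expR; lra.
Qed.

(** The product of [2 cosh y] with [exp (- y^2 / 2)] decreases for nonnegative [y], since its
    derivative has the sign of [sinh y - y cosh y]. Negative arguments follow by evenness. *)
Lemma cosh_le_expR_sqr (R : realType) (x : R) :
  expR x + expR (- x) <= 2 * expR (x ^+ 2 / 2).
Proof.
wlog x_ge0 : x / 0 <= x.
  move=> H; have [|x_lt0] := leP 0 x; first exact: H.
  by rewrite addrC -[X in expR X + _]/(- x) -[in X in _ + X](opprK x) -[x ^+ 2]sqrrN H //; lra.
pose f (y : R) : R := - ((expR y + expR (- y)) * expR (- (y ^+ 2 / 2))).
pose df (y : R) : R :=
  (y * (expR y + expR (- y)) - (expR y - expR (- y))) * expR (- (y ^+ 2 / 2)).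
have /= := @derive_nonneg_ge R f df x _ _ x_ge0.
rewrite /f expr0n mul0r oppr0 expR0 lerN2.
rewrite [expR (- (x ^+ 2 / 2))]expRN ler_pdivrMr ?expR_gt0 // mulr1 -[1 + 1]/2.
apply => y.
- by apply: is_derive_eq; rewrite /df /GRing.scale /=; field.
- by move=> y0; rewrite /df mulr_ge0 ?expR_ge0 // subr_ge0 sinh_le_mul_cosh.
Qed.

(** Independence turns the sum over sign vectors into a product over coordinates. Sums over [w] are
    not normalised, whence the power of 2. *)
Lemma rademacher_mgf (R : realType) (I : finType) (c : I -> R) :
  \sum_(w : {ffun I -> bool}) expR (\sum_p c p * (-1) ^+ w p)
    <= 2 ^+ #|I| * expR ((\sum_p c p ^+ 2) / 2).
Proof.
under eq_bigr => w _ do rewrite expR_sum.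
rewrite -(bigA_distr_bigA (fun p (x : bool) => expR (c p * (-1) ^+ x))).
rewrite mulr_suml expR_sum.
have -> : 2 ^+ #|I| = \prod_(p : I) (2 : R) by rewrite prodr_const cardT.
rewrite -big_split /=; apply: ler_prod => p _.
rewrite big_bool /= expr1 expr0 mulr1 mulrN1.
by rewrite addr_ge0 ?expR_ge0 //= addrC cosh_le_expR_sqr.
Qed.

(* Flipping the signs of row [i] by the sign at [(i, j0)] is a bijection that
   turns the quadratic form into a linear one. *)
Lemma chaos_mgf (R : realType) (I J : finType) (j0 : J) (c : I * J -> R) :
  (forall i, c (i, j0) = 0) ->
  \sum_(w : {ffun I * J -> bool})
      expR (\sum_p c p * (-1) ^+ (w (p.1, j0) (+) w p))
    <= 2 ^+ #|{: I * J}| * expR ((\sum_p c p ^+ 2) / 2).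
Proof.
move=> c0.
pose flip (w : {ffun I * J -> bool}) : {ffun I * J -> bool} :=
  [ffun p => if p.2 == j0 then w p else w (p.1, j0) (+) w p].
have flipK : involutive flip.
  move=> w; apply/ffunP => -[i j]; rewrite !ffunE /= eqxx.
  by case: (eqVneq j j0) => // _; rewrite addbA addbb.
rewrite (reindex_inj (inv_inj flipK)) /=.
apply: le_trans (rademacher_mgf c); apply: ler_sum => w _.
rewrite le_eqVlt; apply/orP; left; apply/eqP; congr expR.
apply: eq_bigr => -[i j] _; rewrite !ffunE /= eqxx.
by case: (eqVneq j j0) => [->|_]; rewrite ?c0 ?mul0r // addbA addbb.
Qed.

(** Chernoff's method: Markov's inequality for the exponential of [l] times the form, with [l] left
    free for a later choice. *)
Lemma chaos_tail (R : realType) (I J : finType) (j0 : J) (c : I * J -> R)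
    (l t : R) :
  (forall i, c (i, j0) = 0) -> 0 <= l ->
  \sum_(w : {ffun I * J -> bool})
      (t <= \sum_p c p * (-1) ^+ (w (p.1, j0) (+) w p))%R%:R
    <= 2 ^+ #|{: I * J}| * expR (l ^+ 2 * (\sum_p c p ^+ 2) / 2 - l * t).
Proof.
move=> c0 l0.
have lc0 i : l * c (i, j0) = 0 by rewrite c0 mulr0.
have := @chaos_mgf R I J j0 (fun p => l * c p) lc0.
under [\sum_p _ ^+ 2]eq_bigr do rewrite exprMn.
rewrite -mulr_sumr => H.
rewrite expRB mulrA ler_pdivlMr ?expR_gt0 //; apply: le_trans H.
rewrite mulr_suml; apply: ler_sum => w _.
have [tw|_] := leP t; last by rewrite mul0r expR_ge0.
rewrite mul1r ler_expR; under [leRHS]eq_bigr do rewrite -mulrA.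
by rewrite -mulr_sumr ler_wpM2l.
Qed.

(** * The random design *)

(** By induction, residual counts stay the true ones as long as all earlier decisions are right.
    Each decision can thus be analysed as if the earlier labels were known, so that successive
    decisions need no joint analysis beyond a union bound. *)
Lemma greedy_correct A b M n T (X : nat -> nat -> bool) (y : nat -> nat)
    (s : labels n) :
  (forall a, y a = \sum_(i < n) (X a i && s i))%N ->
  (forall j : 'I_n,
     decide A b M n T X (fun a => \sum_(i < n | j <= i) (X a i && s i))%N j = s j) ->
  forall j : 'I_n, greedy A b M n T X y j = s j.
Proof.
move=> yE dec.
have resE j : (j <= n)%N -> residual A b M n T X y j =
    (fun a => \sum_(i < n | j <= i) (X a i && s i))%N.
  elim: j => [_|j IHj jn]; first by apply: funext => a; rewrite /= yE.
  apply: funext => a /=; rewrite (IHj (ltnW jn)) (dec (Ordinal jn)).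
  rewrite (bigD1 (Ordinal jn)) //= addKn; apply: eq_bigl => i.
  by rewrite ltn_neqAle andbC eq_sym.
by move=> j; rewrite /greedy resE ?dec // ltnW.
Qed.

(** Remainder 0 modulo [M.+1] marks the full pool, so coin [w (g, c, i)] governs pool
    [g * M.+1 + c.+1]. The existential reads a coin at indices given as naturals. *)
Definition design (M h m n T : nat) (w : {ffun 'I_T * 'I_M * 'I_n -> bool}) :
    pooling n m :=
  [ffun a : 'I_m => [set i : 'I_n | (i < (a %/ M.+1).+1 * h)%N &&
    ((a %% M.+1 == 0)%N || [exists p : 'I_T * 'I_M * 'I_n,
       [&& w p, (p.1.1 == a %/ M.+1 :> nat)%N, (p.1.2.+1 == a %% M.+1 :> nat)%N
         & p.2 == i]])]].

Lemma design_full M h n T (w : {ffun 'I_T * 'I_M * 'I_n -> bool})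
    (g : 'I_T) (i : 'I_n) :
  in_pool (design h (T * M.+1) w) (g * M.+1) i = (i < g.+1 * h)%N.
Proof.
have gm : (g * M.+1 < T * M.+1)%N by rewrite ltn_pmul2r.
rewrite (in_poolE _ (Ordinal gm)) ffunE inE /=.
by rewrite mulnK // modnMl eqxx /= andbT.
Qed.

Lemma design_random M h n T (w : {ffun 'I_T * 'I_M * 'I_n -> bool})
    (g : 'I_T) (c : 'I_M) (i : 'I_n) :
  in_pool (design h (T * M.+1) w) (g * M.+1 + c.+1) i =
    (i < g.+1 * h)%N && w (g, c, i).
Proof.
have cM : (c.+1 < M.+1)%N by rewrite ltnS.
have gm : (g * M.+1 + c.+1 < T * M.+1)%N.
  apply: (@leq_trans (g.+1 * M.+1)); last by rewrite leq_mul2r ltn_ord orbT.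
  by rewrite mulSn addnC ltn_add2r.
rewrite (in_poolE _ (Ordinal gm)) ffunE inE /=.
rewrite divnMDl // divn_small // addn0 modnMDl modn_small //=; congr andb.
apply/existsP/idP => [[[[g' c'] i'] /= /and4P[wp]]|wp].
  by move=> /eqP/val_inj gE /eqP[/val_inj cE] /eqP iE; rewrite -gE -cE -iE.
by exists (g, c, i); rewrite /= wp !eqxx.
Qed.

Definition ones n (s : labels n) (j e : nat) : nat :=
  (\sum_(i < n | j <= i) ((i < e) && s i))%N.

(** The inverse variance scaled by [n]; the successor avoids a null divisor when no ones are
    left. *)
Definition weight (h n : nat) (s : labels n) (j g : nat) : nat :=
  (n %/ (ones s j (g.+1 * h)).+1)%N.

(** The gap between the mean scores of the two labels, which is [n] times the sum [S] of inverse
    variances up to rounding. *)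
Definition margin (R : realType) (M h T n : nat) (s : labels n) (j : nat) : R :=
  M%:R * \sum_(g < T) ((j < g.+1 * h) * weight h s j g)%N%:R.

Definition noise_coef (R : realType) (M h T n : nat) (s : labels n) (j : nat)
    (p : 'I_T * 'I_M * 'I_n) : R :=
  ([&& j < p.1.1.+1 * h, j < p.2, p.2 < p.1.1.+1 * h & s p.2]
    * weight h s j p.1.1)%N%:R.

Definition noise (R : realType) (M h T n : nat) (s : labels n) (j : 'I_n)
    (w : {ffun 'I_T * 'I_M * 'I_n -> bool}) : R :=
  \sum_p noise_coef R h s j p * (-1) ^+ (w (p.1, j) (+) w p).

(** A remaining one at [i] contributes the product of the membership signs of [i] and [j]. For
    [i = j] this product is 1, which isolates [s j]. *)
Lemma vote_sign (R : realType) n (s : labels n) (j : 'I_n) (e : nat)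
    (x : 'I_n -> bool) : (j < e)%N ->
  let r := (\sum_(i < n | j <= i) (((i < e) && x i) && s i))%N in
  (if x j then 2 * r%:R - (ones s j e)%:R else (ones s j e)%:R - 2 * r%:R) =
  (s j)%:R + \sum_(i < n) ([&& j < i, i < e & s i])%N%:R * (-1) ^+ (x j (+) x i)
  :> R.
Proof.
move=> je r.
transitivity (\sum_(i < n | (j <= i)%N) ((i < e) && s i)%N%:R * (-1) ^+ (x j (+) x i) : R).
  rewrite /r /ones !natr_sum.
  case: (x j); rewrite mulr_sumr -sumrB; apply: eq_bigr => i _;
    case: (i < e)%N; case: (s i); case: (x i);
    by rewrite /= ?expr0 ?expr1; lra.
rewrite (bigD1 j) //= je addbb expr0 mulr1; congr (_ + _).
rewrite big_mkcond /=; apply: eq_bigr => i _.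
have -> : (j < i)%N = (j <= i)%N && (i != j) by rewrite ltn_neqAle andbC eq_sym.
by case: andP => _; rewrite ?mul0r.
Qed.

(** Positivity of the left side is the decision for label one; [vote_sign], summed over the random
    pools, splits it into a deterministic part and noise. *)
Lemma vote_margin (R : realType) A b M h n T (s : labels n) (j : 'I_n)
    (w : {ffun 'I_T * 'I_M * 'I_n -> bool}) :
  let X := in_pool (design h (T * M.+1) w) in
  let r := fun a => (\sum_(i < n | j <= i) (X a i && s i))%N in
  (vote_count M n T X r j (pos_vote b))%:R -
  (vote_count M n T X r j (neg_vote A b))%:R =
  b%:R * ((s j)%:R * margin R M h T s j + noise R h s j w)
    - A%:R * margin R M h T s j.
Proof.
move=> X r; rewrite /vote_count !natr_sum -sumrB /margin.
have rE (g : 'I_T) : r (g * M.+1)%N = ones s j (g.+1 * h).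
  by apply: eq_bigr => i _; rewrite /X design_full.
pose F (g : 'I_T) (c : 'I_M) : R := ((j < g.+1 * h) * weight h s j g)%N%:R *
  (b%:R * ((s j)%:R + \sum_(i < n) ([&& j < i, i < g.+1 * h & s i])%N%:R
             * (-1) ^+ (w (g, c, j) (+) w (g, c, i))) - A%:R).
transitivity (\sum_(g < T) \sum_(c < M) F g c).
  apply: eq_bigr => g _; rewrite !natrM -mulrBr !natr_sum -sumrB mulr_sumr.
  apply: eq_bigr => c _; rewrite !natrM -mulrBr mulrA {1}/X design_full /F.
  rewrite rE natrM /weight.
  have [je|] := boolP (j < g.+1 * h)%N; last by rewrite /= !mul0r.
  rewrite -(vote_sign R s (fun i => w (g, c, i)) je) /X design_random je /=.
  rewrite /pos_vote /neg_vote natrD !natrM.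
  have -> : r (g * M.+1 + c.+1)%N =
      (\sum_(i < n | j <= i) ((i < g.+1 * h) && w (g, c, i) && s i))%N.
    by apply: eq_bigr => i _; rewrite /X design_random.
  by case: (w (g, c, j)); rewrite natrD; ring.
pose G (g : 'I_T) : R := ((j < g.+1 * h) * weight h s j g)%N%:R.
have -> : noise R h s j w = \sum_(g < T) \sum_(c < M) \sum_(i < n)
    G g * (([&& j < i, i < g.+1 * h & s i])%N%:R
             * (-1) ^+ (w (g, c, j) (+) w (g, c, i))).
  rewrite /noise pair_big /= pair_big /=; apply: eq_bigr => -[[g c] i] _ /=.
  rewrite mulrA; congr (_ * _); rewrite /noise_coef /G -natrM /=; congr _%:R.
  by case: (j < g.+1 * h)%N; rewrite ?mul0n ?mul1n // mulnC.
rewrite mulrDr !mulr_sumr -big_split -sumrB /=; apply: eq_bigr => g _.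
have MsE (x : R) : M%:R * x = \sum_(c < M) x.
  by rewrite sumr_const card_ord mulr_natl.
rewrite -/(G g) MsE !mulr_sumr -big_split -sumrB /=; apply: eq_bigr => c _.
by rewrite /F -/(G g) -!mulr_sumr; ring.
Qed.

(** A pool of a group with [K] ones left contributes at most [K] squared weights, and
    [K * (n %/ K.+1) <= n] trades one of the two weights for [n]. *)
Lemma noise_coef_sqr (R : realType) (M h T n : nat) (s : labels n) (j : nat) :
  \sum_(p : 'I_T * 'I_M * 'I_n) noise_coef R h s j p ^+ 2
    <= n%:R * margin R M h T s j.
Proof.
pose F (g : 'I_T) (i : 'I_n) : nat :=
  ([&& j < g.+1 * h, j < i, i < g.+1 * h & s i] * weight h s j g)%N.
have -> : \sum_(p : 'I_T * 'I_M * 'I_n) noise_coef R h s j p ^+ 2 =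
    \sum_(g < T) \sum_(c < M) \sum_(i < n) (F g i * F g i)%N%:R.
  by rewrite pair_big /= pair_big /=; apply: eq_bigr => -[[g c] i] _; rewrite natrM.
rewrite /margin mulrCA mulr_sumr mulr_sumr; apply: ler_sum => g _.
rewrite sumr_const card_ord -[leLHS]mulr_natl ler_wpM2l // -natr_sum -natrM ler_nat.
apply: (@leq_trans (\sum_(i < n | j <= i) ((i < g.+1 * h) && s i)
    * ((j < g.+1 * h) * weight h s j g * weight h s j g))%N).
  rewrite [leqRHS]big_mkcond; apply: leq_sum => i _; rewrite /F.
  case: (j < g.+1 * h)%N => //; case: ltnP => //= /ltnW ->.
  by case: (_ && _); rewrite ?mul1n.
have swap (x y z : nat) : (x * (y * z * z) = z * x * (y * z))%N by ring.
rewrite -big_distrl /= swap leq_mul //.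
apply: leq_trans (leq_divM n (ones s j (g.+1 * h)).+1).
by rewrite leq_mul2l leqnSn orbT.
Qed.

(** Here [beta] is the distance from the mean score of the true label to the threshold, in units of
    the margin. An error forces noise of at least [beta] margins, upwards on a zero and downwards on
    a one. *)
Lemma item_error (R : realType) A b M h n T (s : labels n) (j : 'I_n) (beta : R) :
  (0 < b)%N ->
  beta = (if s j then 1 - A%:R / b%:R else A%:R / b%:R) -> 0 <= beta ->
  \sum_(w : {ffun 'I_T * 'I_M * 'I_n -> bool})
    (decide A b M n T (in_pool (design h (T * M.+1) w))
       (fun a => \sum_(i < n | j <= i) (in_pool (design h (T * M.+1) w) a i && s i))%N j
       != s j)%:R
    <= 2 ^+ #|{: 'I_T * 'I_M * 'I_n}|
       * expR (- (beta ^+ 2 / (2 * n%:R) * margin R M h T s j)).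
Proof.
move=> b_gt0 betaE beta_ge0.
have n_gt0 : (0 < n)%N by apply: leq_ltn_trans (ltn_ord j).
have bR_gt0 : 0 < b%:R :> R by rewrite ltr0n.
have nR_gt0 : 0 < n%:R :> R by rewrite ltr0n.
pose sg : R := if s j then -1 else 1.
pose c (p : 'I_T * 'I_M * 'I_n) : R := sg * noise_coef R h s j p.
have sg2 : sg ^+ 2 = 1 by rewrite /sg; case: (s j); rewrite ?sqrrN expr1n.
have c0 p : c (p, j) = 0 by rewrite /c /noise_coef /= ltnn andbF mul0n mulr0.
(* With variance at most [n * mu], the Chernoff exponent [l^2 n mu / 2 - l beta mu] is smallest at
   [l = beta / n]. *)
have l_ge0 : 0 <= beta / n%:R by rewrite divr_ge0.
set mu := margin R M h T s j.
apply: le_trans (le_trans (chaos_tail (beta * mu) c0 l_ge0) _).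
  apply: ler_sum => w _; rewrite ler_nat.
  have [|wrong] := eqVneq (decide _ _ _ _ _ _ _ _) (s j); first by [].
  have -> : \sum_p c p * (-1) ^+ (w (p.1, j) (+) w p) = sg * noise R h s j w.
    by rewrite /noise mulr_sumr; apply: eq_bigr => p _; rewrite mulrA.
  rewrite lt0b.
  have := vote_margin R A b h s j w; rewrite -/mu.
  move: wrong; rewrite /decide -(ltr_nat R) -subr_gt0 => /[swap] -> wrong.
  have {wrong} : if s j then b%:R * (mu + noise R h s j w) - A%:R * mu <= 0
      else 0 <= b%:R * noise R h s j w - A%:R * mu.
    move: wrong; case: (s j); rewrite ?mul1r ?mul0r ?add0r.
      by case: ltP.
    by case: ltP => // /ltW.
  rewrite betaE /sg; set z := noise _ _ _ _ _; set a := A%:R / b%:R.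
  have -> : A%:R = b%:R * a :> R by rewrite mulrC divfK // gt_eqF.
  rewrite -[b%:R * a * mu]mulrA -!mulrBr; case: (s j).
    by rewrite pmulr_rle0 // => H; lra.
  by rewrite pmulr_rge0 // => H; lra.
rewrite ler_wpM2l ?exprn_ge0 // ler_expR.
have V : \sum_p c p ^+ 2 <= n%:R * mu.
  by under eq_bigr do rewrite exprMn sg2 mul1r; exact: noise_coef_sqr.
have nn : n%:R != 0 :> R by rewrite gt_eqF.
apply: (@le_trans _ _ ((beta / n%:R) ^+ 2 * (n%:R * mu) / 2 - beta / n%:R * (beta * mu))).
  by rewrite lerB // ler_wpM2r ?invr_ge0 // ler_wpM2l ?sqr_ge0.
by rewrite le_eqVlt; apply/orP; left; apply/eqP; field.
Qed.

(** * The failure probability of the scheme *)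

Definition image_prob (R : realType) (W : finType) n m (f : W -> pooling n m) :
    {ffun pooling n m -> R} :=
  [ffun G => \sum_(w : W) (f w == G)%:R / #|W|%:R].

Lemma image_prob_ge0 (R : realType) (W : finType) n m (f : W -> pooling n m) G :
  0 <= image_prob R f G.
Proof. by rewrite ffunE sumr_ge0. Qed.

Lemma image_prob_sum1 (R : realType) (W : finType) n m (f : W -> pooling n m) :
  (0 < #|W|)%N -> \sum_G image_prob R f G = 1.
Proof.
move=> W0; under eq_bigr do rewrite ffunE.
rewrite exchange_big /=; under eq_bigr => w _.
  rewrite -mulr_suml (bigD1 (f w)) //= eqxx big1 ?addr0 ?mul1r; last first.
    by move=> G; rewrite eq_sym => /negbTE->.
  over.
by rewrite sumr_const -[LHS]mulr_natl divff // pnatr_eq0 -lt0n.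
Qed.

Definition image_scheme (R : realType) (W : finType) n m (f : W -> pooling n m)
    (W0 : (0 < #|W|)%N) : pooling_scheme R n m :=
  PoolingScheme (image_prob_ge0 R f) (image_prob_sum1 R f W0).

Lemma failure_image_scheme (R : realType) (W : finType) n m k
    (f : W -> pooling n m) (W0 : (0 < #|W|)%N) (D : decoder n m) :
  (0 < #|ground_truths n k|)%N ->
  1 - success_prob k (image_scheme R f W0) D =
  (\sum_(s in ground_truths n k)
    (\sum_w (D (f w) (measure_pools (f w) s) != s)%:R) / #|W|%:R)
  / #|ground_truths n k|%:R.
Proof.
move=> gt0; set N := #|ground_truths n k|.
have NR : N%:R != 0 :> R by rewrite pnatr_eq0 -lt0n.
have WR : #|W|%:R != 0 :> R by rewrite pnatr_eq0 -lt0n.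
have -> : success_prob k (image_scheme R f W0) D =
  (\sum_(s in ground_truths n k)
    (\sum_w (D (f w) (measure_pools (f w) s) == s)%:R) / #|W|%:R) / N%:R.
  rewrite /success_prob exchange_big /= mulr_suml; apply: eq_bigr => s _.
  under eq_bigr => G _ do rewrite ffunE !mulr_suml.
  rewrite exchange_big /= !mulr_suml; apply: eq_bigr => w _.
  rewrite (bigD1 (f w)) //= eqxx big1 ?addr0; last first.
    by move=> G; rewrite eq_sym => /negbTE->; rewrite !mul0r.
  by rewrite mul1r mulrC mulrA.
have one_avg : 1 = (\sum_(s in ground_truths n k) (\sum_(w : W) 1) / #|W|%:R) / N%:R :> R.
  by rewrite !sumr_const divff // divff.
rewrite [X in X - _]one_avg -mulrBl -sumrB; congr (_ / _); apply: eq_bigr => s _.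
rewrite -mulrBl -sumrB; congr (_ / _); apply: eq_bigr => w _.
by case: eqP => _; rewrite ?subrr ?subr0.
Qed.

Lemma result_measure n m (G : pooling n m) (s : labels n) a :
  result (measure_pools G s) a = (\sum_(i < n) (in_pool G a i && s i))%N.
Proof.
rewrite /result; case: insubP => [p _ <-|] /=.
  rewrite ffunE big_mkcond /=; apply: eq_bigr => i _; rewrite in_poolE.
  by case: (i \in G p).
move=> am; rewrite big1 // => i _; apply/eqP; rewrite eqb0 negb_and; apply/orP; left.
apply/existsP => -[p /existsP[q /and3P[/eqP pa _ _]]].
by move: am; rewrite -pa ltn_ord.
Qed.

(** The union bound permitted by [greedy_correct]: every decision is judged on true residual
    counts. *)
Lemma decoder_error (R : realType) A b M n m T (G : pooling n m) (s : labels n) :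
  (greedy_decoder A b M T G (measure_pools G s) != s)%:R <=
  \sum_(j < n) (decide A b M n T (in_pool G)
    (fun a => \sum_(i < n | j <= i) (in_pool G a i && s i))%N j != s j)%:R :> R.
Proof.
have [ok|] := boolP [forall j : 'I_n, decide A b M n T (in_pool G)
    (fun a => \sum_(i < n | j <= i) (in_pool G a i && s i))%N j == s j].
  have -> : greedy_decoder A b M T G (measure_pools G s) = s.
    apply/ffunP => j; rewrite ffunE; apply: greedy_correct => [a|i].
      exact: result_measure.
    by move/forallP: ok => /(_ i)/eqP.
  by rewrite eqxx sumr_ge0.
rewrite negb_forall => /existsP[j jP]; rewrite (bigD1 j) //= jP.
by rewrite (@le_trans _ _ 1) ?lern1 ?leq_b1 // lerDl sumr_ge0.
Qed.

Definition design_scheme (R : realType) M h n T : pooling_scheme R n (T * M.+1) :=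
  @image_scheme R {ffun 'I_T * 'I_M * 'I_n -> bool} n _
    (fun w => design h (T * M.+1) w) (introT card_gt0P (ex_intro _ [ffun=> true] isT)).

Lemma ground_truth_ones n k (s : labels n) : s \in ground_truths n k ->
  (\sum_(j < n) s j)%N = k.
Proof. by rewrite inE => /eqP. Qed.

(** Ground truths that are not [good] are given up as failures. For the others, the error rate of a
    zero is charged to all [n] items and that of a one to the [k] ones. *)
Lemma failure_bound (R : realType) A b M h n k T (good : pred (labels n)) (L : R) :
  (0 < b)%N -> (0 < n)%N -> (0 < #|ground_truths n k|)%N -> A%:R / b%:R <= 1 :> R ->
  (forall s, s \in ground_truths n k -> good s ->
     forall j : 'I_n, n%:R * L <= margin R M h T s j) ->
  1 - success_prob k (design_scheme R M h n T) (greedy_decoder A b M T) <=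
  (\sum_(s in ground_truths n k) (~~ good s)%:R) / #|ground_truths n k|%:R
    + n%:R * expR (- ((A%:R / b%:R) ^+ 2 / 2 * L))
    + k%:R * expR (- ((1 - A%:R / b%:R) ^+ 2 / 2 * L)).
Proof.
move=> b0 n0 gt0 a1 Lgood; set a := A%:R / b%:R; rewrite failure_image_scheme //.
have a0 : 0 <= a by rewrite divr_ge0.
set N := #|ground_truths n k|; set W := #|_|.
have NR : 0 < N%:R :> R by rewrite ltr0n.
have nR : 0 < n%:R :> R by rewrite ltr0n.
have WE : W%:R = 2 ^+ #|{: 'I_T * 'I_M * 'I_n}| :> R.
  by rewrite /W card_ffun card_bool natrX.
have WR : 0 < W%:R :> R by rewrite WE exprn_gt0.
set E := n%:R * _; set F := k%:R * _.
rewrite -addrA ler_pdivrMr // mulrDl divfK ?gt_eqF //.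
have -> : (E + F) * N%:R = \sum_(s in ground_truths n k) (E + F).
  by rewrite sumr_const mulr_natr.
rewrite -big_split /=; apply: ler_sum => s sk.
have EF0 : 0 <= E + F by rewrite addr_ge0 // mulr_ge0 ?expR_ge0.
have [gs|ngs] := boolP (good s); last first.
  rewrite (@le_trans _ _ 1) ?lerDl // ler_pdivrMr // mul1r.
  apply: le_trans (_ : \sum_w 1 <= _); first by apply: ler_sum => w _; rewrite lern1 leq_b1.
  by rewrite sumr_const.
rewrite add0r ler_pdivrMr //.
apply: le_trans (ler_sum _ (fun w _ => decoder_error R A b M T _ s)) _.
rewrite exchange_big /=.
pose beta (j : 'I_n) : R := if s j then 1 - a else a.
have beta0 j : 0 <= beta j by rewrite /beta; case: (s j); rewrite ?subr_ge0.
apply: le_trans (ler_sum _ (fun j _ => item_error M h T b0 erefl (beta0 j))) _.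
rewrite -mulr_sumr -WE mulrC ler_wpM2r // ?ler0n //.
apply: (@le_trans _ _ (\sum_(j < n) (expR (- (a ^+ 2 / 2 * L))
     + (s j)%:R * expR (- ((1 - a) ^+ 2 / 2 * L))))).
  apply: ler_sum => j _.
  have bound : expR (- (beta j ^+ 2 / (2 * n%:R) * margin R M h T s j)) <=
      expR (- (beta j ^+ 2 / 2 * L)).
    rewrite ler_expR lerN2 invfM (mulrA (beta j ^+ 2)) -[leRHS]mulrA ler_wpM2l //.
      by rewrite mulr_ge0 ?sqr_ge0.
    by rewrite ler_pdivlMl // Lgood.
  apply: le_trans bound _; rewrite /beta; case: (s j).
    by rewrite mul1r lerDr expR_ge0.
  by rewrite mul0r addr0.
rewrite big_split /= sumr_const card_ord -mulr_suml -natr_sum (ground_truth_ones sk).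
by rewrite -[X in X + _]mulr_natl.
Qed.

(** * Concentration of the number of ones in an interval *)

Definition n_containing (n k : nat) (A : {set 'I_n}) : nat :=
  (\sum_(s in ground_truths n k) [forall i in A, s i])%N.

(** Exchanging the labels of [x] and [y] permutes the ground truths. *)
Lemma n_containing_swap n k (A : {set 'I_n}) (x y : 'I_n) :
  x \notin A -> y \notin A -> (n_containing k (x |: A) <= n_containing k (y |: A))%N.
Proof.
move=> xA yA.
pose swap (s : labels n) : labels n := [ffun i => s (tperm x y i)].
have swapK : involutive swap.
  by move=> s; apply/ffunP => i; rewrite !ffunE tpermK.
rewrite /n_containing (reindex_inj (inv_inj swapK)) /=.
rewrite (eq_bigl (fun s => s \in ground_truths n k)) => [|s].
  apply: leq_sum => s _; case: (boolP [forall i in x |: A, swap s i]) => // /forall_inP sx.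
  rewrite lt0b; apply/forall_inP => i /setU1P[->|iA].
    by have := sx x (setU11 _ _); rewrite ffunE tpermL.
  have := sx i (setU1r _ iA); rewrite ffunE tpermD //.
    by apply: contraNneq xA => ->.
  by apply: contraNneq yA => ->.
rewrite !inE (reindex_inj (@perm_inj _ (tperm x y))) /=.
by congr (_ == _); apply: eq_bigr => i _; rewrite ffunE tpermK.
Qed.

(** Double counting of the pairs formed by a ground truth equal to one on [A] and one of its [k]
    ones, which lies outside or inside [A]. *)
Lemma n_containing_sum n k (A : {set 'I_n}) :
  (\sum_(x | x \notin A) n_containing k (x |: A) + #|A| * n_containing k A
   = k * n_containing k A)%N.
Proof.
rewrite /n_containing exchange_big /= !big_distrr /= -big_split /=.
apply: eq_bigr => s; rewrite inE => /eqP sk.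
have [sA|sA] := boolP [forall i in A, s i]; last first.
  rewrite !muln0 addn0 big1 // => x _; apply/eqP; rewrite eqb0.
  apply: contra sA => /forall_inP sA; apply/forall_inP => i iA.
  by apply: sA; rewrite setU1r.
rewrite !muln1 -[RHS]sk addnC [RHS](bigID (fun x => x \in A)) /=; congr (_ + _)%N.
  rewrite -sum1_card; apply: eq_bigr => i iA.
  by move/forall_inP: sA => /(_ i iA) ->.
apply: eq_bigr => x xA; congr nat_of_bool; apply/forall_inP/idP => [|sx i].
  by apply; rewrite setU11.
by case/setU1P => [->//|iA]; move/forall_inP: sA; apply.
Qed.

(** Sampling without replacement covers [A] no more often than independent labels of mean [k / n]
    do. By symmetry the terms of [n_containing_sum] are equal, so adding a point to [B] multiplies
    the count by [(k - #|B|) / (n - #|B|)], which is at most [k / n]. *)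
Lemma n_containing_bound (R : realType) n k (A : {set 'I_n}) : (k <= n)%N ->
  (n_containing k A)%:R <= #|ground_truths n k|%:R * (k%:R / n%:R) ^+ #|A| :> R.
Proof.
move=> kn.
elim: {A}_.+1 {-2}A (ltnSn #|A|) => // d IHd A Ad.
have [->|[x xA]] := set_0Vmem A.
  rewrite cards0 mulr1 ler_nat -sum1_card /n_containing.
  by apply: leq_sum => s _; rewrite leq_b1.
pose B := A :\ x.
have xB : x \notin B by rewrite setD11.
have AE : A = x |: B by rewrite finset.setD1K.
have cA : #|A| = #|B|.+1 by rewrite AE cardsU1 xB.
have Bn : (#|B| < n)%N by rewrite -cA; have := max_card (mem A); rewrite card_ord.
have n0 : 0 < n%:R :> R by rewrite ltr0n (leq_ltn_trans _ Bn).
apply: (@le_trans _ _ (k%:R / n%:R * (n_containing k B)%:R)); last first.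
  rewrite cA exprS mulrCA ler_wpM2l ?divr_ge0 // IHd //.
  by rewrite -ltnS -cA.
rewrite mulrAC ler_pdivlMr //.
have := n_containing_sum k B.
have -> : (\sum_(y | y \notin B) n_containing k (y |: B)
    = (n - #|B|) * n_containing k A)%N.
  rewrite (eq_bigr (fun=> n_containing k A)) => [|y yB]; last first.
    by apply/eqP; rewrite AE eqn_leq !n_containing_swap.
  rewrite sum_nat_const; congr (_ * _)%N.
  apply: (@addnI #|B|); rewrite subnKC ?(ltnW Bn) //.
  exact: etrans (cardC (mem B)) (card_ord n).
set u := n_containing k A; set v := n_containing k B; set c := #|B|.
rewrite -!natrM ler_nat => e.
have {}e : (n * u + c * v = k * v + c * u)%N.
  by have := leq_mul (ltnW Bn) (leqnn u); move: e; rewrite mulnBl; lia.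
have : (c * u <= c * v)%N.
  rewrite leq_mul2l; apply/orP; right; apply: leq_sum => s _.
  case: (boolP [forall i in A, s i]) => // /forall_inP sA.
  rewrite lt0b; apply/forall_inP => i iB; apply: sA.
  by rewrite AE setU1r.
by rewrite mulnC; lia.
Qed.

(** Both powers expand over the subsets [A] of [W], and [n_containing_bound] compares them term by
    term. *)
Lemma ones_mgf (R : realType) n k (W : {set 'I_n}) (eps : R) :
  (k <= n)%N -> 0 <= eps ->
  \sum_(s in ground_truths n k) (1 + eps) ^+ (\sum_(i in W) s i)%N
    <= #|ground_truths n k|%:R * (1 + eps * (k%:R / n%:R)) ^+ #|W|.
Proof.
move=> kn eps0.
have expand (x : R) (s : 'I_n -> bool) : (1 + x) ^+ (\sum_(i in W) s i)%N =
    \sum_(A : {set 'I_n} | A \subset W) x ^+ #|A| * [forall i in A, s i]%:R.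
  transitivity (\prod_i ((if (i \in W) && s i then x else 0) + 1)).
    rewrite expr_sum big_mkcond; apply: eq_bigr => i _.
    by case: (i \in W); case: (s i); rewrite ?expr0 ?expr1 ?add0r // addrC.
  rewrite bigA_distr [RHS]big_mkcond; apply: eq_bigr => A _ /=.
  have [AW|] := boolP (A \subset W); last first.
    case/subsetPn => i iA iW; rewrite (bigD1 i) //= iA (negbTE iW) /=.
    by rewrite mul0r.
  have [sA|] := boolP [forall i in A, s i].
    rewrite mulr1 -prodr_const [RHS]big_mkcond; apply: eq_bigr => i _.
    case: ifP => // iA; rewrite (fintype.subsetP AW) //.
    by move/forall_inP: sA => ->.
  rewrite negb_forall => /existsP[i]; rewrite negb_imply => /andP[iA si].
  by rewrite (bigD1 i) //= iA (negbTE si) andbF mul0r mulr0.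
under eq_bigr do rewrite expand.
rewrite exchange_big /=.
have -> : (1 + eps * (k%:R / n%:R)) ^+ #|W| =
    \sum_(A : {set 'I_n} | A \subset W) (eps * (k%:R / n%:R)) ^+ #|A|.
  rewrite -sum1_card; have := expand (eps * (k%:R / n%:R)) (fun=> true).
  move=> ->; apply: eq_bigr => A _.
  have -> : [forall i in A, true] by apply/forall_inP.
  by rewrite mulr1.
rewrite mulr_sumr; apply: ler_sum => A _.
rewrite -mulr_sumr -natr_sum exprMn mulrCA ler_wpM2l ?exprn_ge0 //.
exact: n_containing_bound.
Qed.

(** Chernoff's bound with base [1 + eps]. As [ln (1 + eps) >= eps / (1 + eps)], the exponent is at
    most [mu] times [eps - eps (1 + 2 eps) / (1 + eps) = - eps^2 / (1 + eps)]. *)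
Lemma ones_tail (R : realType) n k (j e : nat) (eps mu : R) :
  (k <= n)%N -> (0 < n)%N -> 0 < eps -> k%:R * (e - j)%N%:R / n%:R <= mu ->
  \sum_(s in ground_truths n k) ((1 + 2 * eps) * mu <= (ones s j e)%:R)%R%:R
    <= #|ground_truths n k|%:R * expR (- (eps ^+ 2 / (1 + eps) * mu)).
Proof.
move=> kn n0 eps0 mu_ge.
have eps1 : 0 < 1 + eps by rewrite addr_gt0.
have nR : 0 < n%:R :> R by rewrite ltr0n.
pose W : {set 'I_n} := [set i : 'I_n | (j <= i < e)%N].
have onesE (s : labels n) : ones s j e = (\sum_(i in W) s i)%N.
  rewrite /ones big_mkcond [RHS]big_mkcond; apply: eq_bigr => i _; rewrite inE.
  by case: (j <= i)%N; case: (i < e)%N.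
have cardW : (#|W| <= e - j)%N.
  rewrite cardE -(size_map val) -[leqRHS](size_iota j); apply: uniq_leq_size.
    by rewrite map_inj_uniq ?enum_uniq //; exact: val_inj.
  move=> i /mapP[i']; rewrite mem_enum inE => /andP[ji ie] ->.
  by rewrite mem_iota ji /= subnKC // (leq_trans ji (ltnW ie)).
have ln_ge : eps / (1 + eps) <= ln (1 + eps).
  rewrite -lerN2 -lnV ?posrE //.
  rewrite [X in ln X](_ : _ = 1 + (- (eps / (1 + eps)))); last by field; lra.
  by apply: le_ln1Dx; rewrite ltrN2 ltr_pdivrMr //; lra.
rewrite -(ler_pM2r (expR_gt0 (eps / (1 + eps) * ((1 + 2 * eps) * mu)))).
apply: (@le_trans _ _ (\sum_(s in ground_truths n k) (1 + eps) ^+ (\sum_(i in W) s i)%N)).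
  rewrite mulr_suml; apply: ler_sum => s _; rewrite -onesE.
  have [h|_] := leP ((1 + 2 * eps) * mu) (ones s j e)%:R; last first.
    by rewrite mul0r exprn_ge0 // ltW.
  rewrite mul1r -[X in X ^+ _]lnK ?posrE // -expRM_natl ler_expR.
  apply: (@le_trans _ _ (eps / (1 + eps) * (ones s j e)%:R)).
    by rewrite ler_wpM2l // divr_ge0 // ltW.
  by rewrite mulrC ler_wpM2l.
apply: le_trans (ones_mgf W kn (ltW eps0)) _.
rewrite -[leRHS]mulrA -expRD ler_wpM2l //.
apply: (@le_trans _ _ (expR (eps * mu))); last first.
  by rewrite ler_expR le_eqVlt; apply/orP; left; apply/eqP; field; lra.
apply: (@le_trans _ _ (expR (eps * (k%:R / n%:R)) ^+ #|W|)).
  by rewrite lerXn2r ?nnegrE ?expR_ge0 ?expR_ge1Dx // addr_ge0 // mulr_ge0 ?divr_ge0 // ltW.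
rewrite -expRM_natl ler_expR mulrCA ler_wpM2l ?(ltW eps0) //.
apply: le_trans mu_ge; rewrite mulrCA -mulrA ler_wpM2l //.
by rewrite ler_wpM2r ?invr_ge0 ?ler_nat.
Qed.

(** * The margin as a harmonic sum *)

(** Telescoping of [ln (x + 1) - ln x <= 1 / x], where [x] is the distance from group [a] to group
    [g], counted from 1. Groups before [a] have truncated distance 0 and are discarded by
    [q0 > 0]. *)
Lemma harmonic_ge_ln (R : realType) (a q0 T : nat) :
  (0 < q0)%N -> (q0 <= (T - a).+1)%N ->
  ln (T - a).+1%:R - ln q0%:R
    <= \sum_(g < T) (q0 <= g.+1 - a)%N%:R / (g.+1 - a)%N%:R :> R.
Proof.
move=> q00; elim: T => [|T IHT] qT.
  by rewrite big_ord0 subr_le0 ler_ln ?posrE ?ltr0n // ler_nat; move: qT q00; lia.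
rewrite big_ord_recr /=; have [qT'|Tq] := leqP q0 (T - a).+1; last first.
  have -> : q0 = (T.+1 - a).+1 by move: qT Tq; lia.
  by rewrite subrr addr_ge0 ?sumr_ge0 // => [i _|]; rewrite divr_ge0.
have {}IHT := IHT qT'.
have [aT|Ta] := leqP a T; last first.
  have -> : (T.+1 - a = T - a)%N by move: Ta; lia.
  apply: le_trans IHT _; rewrite lerDl divr_ge0 //.
rewrite subSn // qT'; set x := (T - a).+1.
have x0 : 0 < x%:R :> R by rewrite ltr0n.
suff H : ln x.+1%:R - ln x%:R <= 1 / x%:R :> R.
  by apply: le_trans (lerD IHT H); rewrite -/x; lra.
rewrite -ln_div ?posrE ?ltr0n // -natr1 mulrDl divff ?gt_eqF //.
by apply: le_ln1Dx; apply: lt_le_trans (_ : 0 <= _); rewrite ?divr_ge0 ?ltrN10.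
Qed.

(** [kappa] stands for the expected number of ones in [h] consecutive items. Nothing is asked of
    intervals shorter than [q0] strides, which hold too few ones to concentrate. *)
Definition balanced (R : realType) (h n T q0 : nat) (eps kappa : R) (s : labels n) :
    bool :=
  [forall j : 'I_n, forall g : 'I_T, (q0 <= g.+1 - j %/ h)%N ==>
    ((ones s j (g.+1 * h))%:R < (1 + 2 * eps) * ((g.+1 - j %/ h)%N%:R * kappa))].

Lemma unbalanced_count (R : realType) (h n k T q0 : nat) (eps kappa : R) :
  (k <= n)%N -> (0 < n)%N -> (0 < h)%N -> 0 < eps -> kappa = h%:R * k%:R / n%:R ->
  \sum_(s in ground_truths n k) (~~ balanced h T q0 eps kappa s)%:R
    <= #|ground_truths n k|%:R *
       (n%:R * T%:R * expR (- (eps ^+ 2 / (1 + eps) * (q0%:R * kappa)))).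
Proof.
move=> kn n0 h0 eps0 kappaE.
have kappa0 : 0 <= kappa by rewrite kappaE divr_ge0 // mulr_ge0.
pose mu (j : 'I_n) (g : 'I_T) : R := (g.+1 - j %/ h)%N%:R * kappa.
apply: (@le_trans _ _ (\sum_(s in ground_truths n k) \sum_(j < n)
   \sum_(g < T | (q0 <= g.+1 - j %/ h)%N)
     ((1 + 2 * eps) * mu j g <= (ones s j (g.+1 * h))%:R)%R%:R)).
  apply: ler_sum => s _; case: (boolP (balanced _ _ _ _ _ _)) => [_|].
    by rewrite /= sumr_ge0 // => j _; rewrite sumr_ge0.
  rewrite negb_forall => /existsP[j]; rewrite negb_forall => /existsP[g].
  rewrite negb_imply -leNgt => /andP[qg onesg].
  rewrite (bigD1 j) //= (bigD1 g) //= onesg -addrA lerDl addr_ge0 ?sumr_ge0 //.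
  by move=> i _; rewrite sumr_ge0.
rewrite exchange_big /=; under eq_bigr do rewrite exchange_big /=.
set B := #|_|%:R * (_ * _).
have -> : B = \sum_(j < n) \sum_(g < T) (#|ground_truths n k|%:R *
     expR (- (eps ^+ 2 / (1 + eps) * (q0%:R * kappa)))).
  by rewrite !sumr_const !card_ord -mulrnA -[RHS]mulr_natl natrM /B; ring.
apply: ler_sum => j _; rewrite big_mkcond /=; apply: ler_sum => g _.
case: ifP => qg; last by rewrite mulr_ge0 ?expR_ge0.
have tail := @ones_tail R n k j (g.+1 * h) eps (mu j g) kn n0 eps0.
apply: le_trans (tail _) _.
  (* Rounding [j] down to a multiple of [h] only lengthens the interval. *)
  rewrite /mu kappaE mulrA ler_wpM2r ?invr_ge0 // mulrA mulrC ler_wpM2r //.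
  rewrite -natrM ler_nat mulnBl leq_sub2l //; exact: leq_divM.
rewrite ler_wpM2l // ler_expR lerN2 ler_wpM2l ?divr_ge0 ?sqr_ge0 //.
  by rewrite addr_ge0 // ltW.
by rewrite ler_wpM2r // ler_nat.
Qed.

(** At distance [q >= q0] a balanced truth has [K.+1 <= (1 + 3 eps) q kappa], the third [eps]
    absorbing the successor. Rounding the weights down costs at most 1 per group, hence the term
    [T]. *)
Lemma margin_ge (R : realType) (M h n T q0 : nat) (eps kappa : R) (s : labels n)
    (j : 'I_n) :
  (0 < h)%N -> (0 < q0)%N -> 0 < eps -> 0 < kappa -> 1 <= eps * (q0%:R * kappa) ->
  (q0 <= (T - j %/ h).+1)%N -> balanced h T q0 eps kappa s ->
  M%:R * (n%:R / ((1 + 3 * eps) * kappa) * (ln (T - j %/ h).+1%:R - ln q0%:R) - T%:R)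
    <= margin R M h T s j.
Proof.
move=> h0 q00 eps0 kappa0 q0big qT /forallP/(_ j)/forallP bal.
have d0 : 0 < (1 + 3 * eps) * kappa by rewrite mulr_gt0 //; lra.
rewrite ler_wpM2l //.
apply: (@le_trans _ _ (n%:R / ((1 + 3 * eps) * kappa) *
   \sum_(g < T) (q0 <= g.+1 - j %/ h)%N%:R / (g.+1 - j %/ h)%N%:R - T%:R)).
  by rewrite lerB // ler_wpM2l ?divr_ge0 ?(ltW d0) // harmonic_ge_ln.
have -> : T%:R = \sum_(g < T) 1 :> R by rewrite sumr_const card_ord.
rewrite mulr_sumr -sumrB; apply: ler_sum => g _.
have [qg|] := leqP q0 (g.+1 - j %/ h); last first.
  by rewrite mul0r mulr0 sub0r => _; apply: le_trans (ler0n _ _); lra.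
have {}bal := implyP (bal g) qg.
set q := (g.+1 - j %/ h)%N in qg bal *.
have jg : (j < g.+1 * h)%N.
  rewrite -ltn_divLR // ltnNge; apply: contraL qg => ?; rewrite -ltnNge /q; lia.
rewrite jg mul1n /weight; set K := ones _ _ _ in bal *.
have q1 : 0 < q%:R :> R by rewrite ltr0n (leq_trans q00).
have K1 : K.+1%:R <= (1 + 3 * eps) * (q%:R * kappa) :> R.
  rewrite -natr1; have : eps * (q0%:R * kappa) <= eps * (q%:R * kappa).
    by rewrite ler_wpM2l ?(ltW eps0) // ler_wpM2r ?(ltW kappa0) // ler_nat.
  by move: bal q0big; nra.
rewrite lerBlDr; apply: (@le_trans _ _ (n%:R / K.+1%:R)).
  rewrite mul1r -mulrA ler_wpM2l // -invfM lef_pV2 ?posrE ?ltr0n //; last first.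
    by rewrite mulr_gt0.
  by rewrite -mulrA [kappa * _]mulrC.
rewrite ler_pdivrMr ?ltr0n // natr1 -natrM ler_nat ltnW //.
exact: ltn_ceil.
Qed.

(** * Asymptotics *)

Local Open Scope classical_set_scope.
Local Open Scope ring_scope.

Lemma near_le_ln (R : realType) (C : R) : \forall n \near \oo, C <= ln n%:R.
Proof.
near=> n; have n_ge : expR C <= n%:R by near: n; exact: nbhs_infty_ger.
by rewrite -[C]expRK ler_ln ?posrE ?expR_gt0 // (lt_le_trans (expR_gt0 C)).
Unshelve. all: by end_near. Qed.

(** From [ln x = 2 ln (sqrt x) <= 2 sqrt x], the left side is of order [sqrt y]. This disposes of
    the doubly logarithmic term [ln q0]. *)
Lemma ln_le_linear (R : realType) (A e y : R) : 0 < A -> 0 < e ->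
  (4 * A + 4) / e ^+ 2 + 1 <= y -> ln (A * y + 1) <= e * y.
Proof.
move=> A0 e0 hy.
have y1 : 1 <= y by apply: le_trans hy; rewrite lerDr divr_ge0 ?sqr_ge0 //; lra.
have x0 : 0 < A * y + 1 by nra.
rewrite -[A * y + 1]sqr_sqrtr ?(ltW x0) // lnXn ?sqrtr_gt0 //.
set z := Num.sqrt _; have z0 : 0 < z by rewrite sqrtr_gt0.
have lnz : ln z <= z by rewrite ltW // ln_sublinear.
suff : 2 * z <= e * y by rewrite mulr2n; lra.
have e2 : 0 < e ^+ 2 by rewrite exprn_gt0.
have hy' : 4 * A + 4 <= e ^+ 2 * y.
  have := ler_wpM2l (ltW e2) hy; rewrite mulrDr mulrC divfK ?gt_eqF //; lra.
rewrite -(@ler_pXn2r _ 2) ?nnegrE ?mulr_ge0 ?(ltW z0) ?(ltW e0) //; try lra.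
rewrite exprMn /z sqr_sqrtr ?(ltW x0) //; rewrite exprMn.
have : (4 * A + 4) * y <= e ^+ 2 * y * y by rewrite ler_wpM2r //; lra.
by rewrite (expr2 y); lra.
Qed.

Lemma natr_powR (R : realType) (theta : R) (n : nat) : (0 < n)%N ->
  n%:R `^ theta = expR (theta * ln n%:R).
Proof. by move=> n0; rewrite mulrC expRM lnK // posrE ltr0n. Qed.

Lemma sparsity_le (R : realType) (theta : R) (n : nat) :
  (sparsity theta n)%:R <= n%:R `^ theta.
Proof. by rewrite truncn_le powR_ge0. Qed.

Lemma sparsity_leq (R : realType) (theta : R) (n : nat) :
  0 < theta -> theta < 1 -> (sparsity theta n <= n)%N.
Proof.
move=> t0 t1; rewrite -(ler_nat R); apply: le_trans (sparsity_le _ _) _.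
have [->|n0] := posnP n; first by rewrite powR0 // gt_eqF.
by apply: ler1_powR; rewrite ?ler1n // ltW.
Qed.

Lemma ground_truths_gt0 n k : (k <= n)%N -> (0 < #|ground_truths n k|)%N.
Proof.
move=> kn; apply/card_gt0P; exists [ffun i : 'I_n => (i < k)%N]; rewrite inE.
under eq_bigr do rewrite ffunE.
apply/eqP; transitivity (\sum_(i < n | i < k) 1)%N.
  by rewrite [RHS]big_mkcond; apply: eq_bigr => i _; case: (i < k)%N.
by rewrite -(big_ord_widen n (fun=> 1%N)) // sum1_card card_ord.
Qed.

(** * Parameters of the design and their asymptotics *)

Definition n_groups (R : realType) (c theta : R) (M n : nat) : nat :=
  Num.truncn (c * (sparsity theta n)%:R / M.+1%:R).

(** The [T] strides overshoot and would cover [(1 + eps) n] items, so that even the last item keeps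
    a fixed fraction of the groups beyond it and its harmonic sum is still about [ln T]. *)
Definition stride (R : realType) (eps : R) (T n : nat) : nat :=
  (Num.truncn ((1 + eps) * n%:R / T%:R)).+1.

Lemma n_groups_le (R : realType) (c theta : R) (M n : nat) : 0 <= c ->
  (n_groups c theta M n * M.+1)%N%:R <= c * (sparsity theta n)%:R.
Proof.
by move=> c0; rewrite natrM -ler_pdivlMr ?ltr0n // truncn_le divr_ge0 // mulr_ge0.
Qed.

(** Solves [eps^2 / (1 + eps) * q0 * kappa = 3 ln n] for [q0 / ln n] at the lower bound [M.+1 / c]
    of [kappa]. *)
Definition span_rate (R : realType) (c eps : R) (M : nat) : R :=
  3 * (1 + eps) / eps ^+ 2 * (c / M.+1%:R).

Definition min_span (R : realType) (c eps : R) (M n : nat) : nat :=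
  (Num.truncn (span_rate c eps M * ln n%:R)).+1.

(** For large [n], rounding down costs at most a factor 2 in [k] and a factor [1 + eps] in the
    number of groups. *)
Lemma n_groups_ge (R : realType) (c theta eps : R) (M n : nat) :
  0 < c -> 0 < eps -> 0 < theta -> (0 < n)%N ->
  2 * (M.+1%:R * (1 + eps)) / (c * eps) + 2 <= theta * ln n%:R ->
  let k := sparsity theta n in
  [/\ expR (theta * ln n%:R) / 2 <= k%:R :> R, 0 < k%:R :> R
    & c * k%:R / (M.+1%:R * (1 + eps)) <= (n_groups c theta M n)%:R :> R].
Proof.
move=> c0 eps0 t0 n0 y_ge k; set B : R := M.+1%:R in y_ge *.
have B0 : 0 < B by rewrite ltr0n.
set x := expR _.
have x_ge : 2 * (B * (1 + eps)) / (c * eps) + 2 <= x.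
  by apply: le_trans y_ge _; apply: le_trans (expR_ge1Dx _); lra.
have frac0 : 0 <= 2 * (B * (1 + eps)) / (c * eps).
  by rewrite divr_ge0 ?mulr_ge0 ?(ltW eps0) ?(ltW c0) ?(ltW B0) //; lra.
have k_gt : x < k%:R + 1 by rewrite /x -(natr_powR theta n0) natr1 truncnS_gt.
have k_ge : x / 2 <= k%:R by move: k_gt x_ge frac0; set f := _ / (c * eps); lra.
have T_gt : c * k%:R / B < (n_groups c theta M n)%:R + 1 by rewrite natr1 truncnS_gt.
split => //; first by move: k_ge x_ge frac0; lra.
have big : B * (1 + eps) / (c * eps) <= k%:R.
  apply: le_trans k_ge; move: x_ge; rewrite -mulrA; lra.
suff : c * k%:R / (B * (1 + eps)) + 1 <= c * k%:R / B.
  by move=> H; rewrite -(lerD2r 1); exact: le_trans H (ltW T_gt).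
have -> : c * k%:R / B = c * k%:R / (B * (1 + eps)) + (c * eps) * k%:R / (B * (1 + eps)).
  by field; lra.
by rewrite lerD2l ler_pdivlMr ?mulr_gt0 ?mul1r // ?addr_gt0 // -ler_pdivrMl ?mulr_gt0 // mulrC.
Qed.

(** Since [h] is about [n / T] and [T] about [c k / M.+1], [kappa] is about [M.+1 / c]. Its upper
    bound loses two factors [1 + eps], and one more [eps] for rounding the stride up. *)
Lemma stride_bounds (R : realType) (c theta eps : R) (M n : nat) :
  0 < c -> 0 < eps -> eps <= 1 -> 0 < theta -> (0 < n)%N ->
  2 * (M.+1%:R * (1 + eps)) / (c * eps) + 2 <= theta * ln n%:R ->
  c / (M.+1%:R * eps) <= (1 - theta) * ln n%:R ->
  let k := sparsity theta n in let T := n_groups c theta M n in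
  let h := stride eps T n in let kappa := h%:R * k%:R / n%:R : R in
  [/\ M.+1%:R / c <= kappa, kappa <= (1 + 4 * eps) * (M.+1%:R / c),
      c * k%:R / n%:R <= M.+1%:R * eps
    & forall j, (j < n)%N -> eps / (1 + eps) * T%:R <= (T - j %/ h)%:R :> R].
Proof.
move=> c0 eps0 eps1 t0 n0 y_ge1 y_ge2 k T h kappa.
have [k_ge k0 T_ge] := n_groups_ge c0 eps0 t0 n0 y_ge1.
rewrite -/k -/T in k_ge k0 T_ge.
set B : R := M.+1%:R in y_ge1 y_ge2 T_ge *.
have B0 : 0 < B by rewrite ltr0n.
have nR : 0 < n%:R :> R by rewrite ltr0n.
have T0 : 0 < T%:R :> R.
  apply: lt_le_trans T_ge; rewrite divr_gt0 ?mulr_gt0 //; lra.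
have T_le : T%:R <= c * k%:R / B by rewrite truncn_le divr_ge0 ?mulr_ge0 // ltW.
have h_gt : (1 + eps) * n%:R / T%:R < h%:R by rewrite truncnS_gt.
have h_le : h%:R <= (1 + eps) * n%:R / T%:R + 1.
  rewrite /h /stride -natr1 lerD2r truncn_le divr_ge0 ?mulr_ge0 //; lra.
have kn : c * k%:R / n%:R <= B * eps.
  have e_ge : c / (B * eps) <= expR ((1 - theta) * ln n%:R).
    by apply: le_trans y_ge2 _; apply: le_trans (expR_ge1Dx _); lra.
  rewrite ler_pdivrMr // -ler_pdivrMl ?mulr_gt0 // mulrA [_^-1 * c]mulrC.
  have k_le : k%:R <= expR (theta * ln n%:R).
    by rewrite -natr_powR // sparsity_le.
  apply: le_trans (ler_pM _ _ e_ge k_le) _ => //.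
    by rewrite divr_ge0 ?mulr_ge0 // ltW.
  by rewrite -expRD -mulrDl subrK mul1r lnK ?posrE.
have kT : k%:R / T%:R <= (1 + eps) * (B / c).
  rewrite ler_pdivrMr //; move: T_ge; rewrite ler_pdivrMr; last first.
    by rewrite mulr_gt0 //; lra.
  move=> H; rewrite -(ler_pM2l c0); apply: le_trans H _.
  by rewrite le_eqVlt; apply/orP; left; apply/eqP; field; lra.
split => //.
- rewrite /kappa ler_pdivrMr // mulrAC ler_pdivlMr // .
  apply: (@le_trans _ _ ((1 + eps) * n%:R / T%:R * k%:R * c)); last first.
    by rewrite ler_wpM2r ?(ltW c0) // ler_wpM2r ?(ltW k0) // ltW.
  have : 1 <= c * k%:R / B / T%:R by rewrite ler_pdivlMr // mul1r.
  have -> : (1 + eps) * n%:R / T%:R * k%:R * c =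
      B * n%:R * ((1 + eps) * (c * k%:R / B / T%:R)) by field; lra.
  move=> H; rewrite -[leLHS]mulr1 ler_wpM2l ?mulr_ge0 ?(ltW B0) //.
  by move: H eps0; set z := c * k%:R / B / T%:R; nra.
- apply: (@le_trans _ _ (((1 + eps) * n%:R / T%:R + 1) * k%:R / n%:R)).
    by rewrite /kappa ler_pM2r ?invr_gt0 // ler_pM2r.
  have -> : ((1 + eps) * n%:R / T%:R + 1) * k%:R / n%:R =
      (1 + eps) * (k%:R / T%:R) + c * k%:R / n%:R / c by field; lra.
  have H1 : (1 + eps) * (k%:R / T%:R) <= (1 + eps) * ((1 + eps) * (B / c)).
    by rewrite ler_wpM2l //; lra.
  have H2 : c * k%:R / n%:R / c <= B * eps / c by rewrite ler_wpM2r ?invr_ge0 // ltW.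
  apply: le_trans (lerD H1 H2) _.
  have Bc : 0 < B / c by rewrite divr_gt0.
  have -> : B * eps / c = eps * (B / c) by field; lra.
  have : 0 <= B / c * (eps * (1 - eps)).
    by rewrite mulr_ge0 ?(ltW Bc) // mulr_ge0 ?subr_ge0 // ltW.
  by set u := B / c; lra.
- move=> j jn.
  have h0 : 0 < h%:R :> R by rewrite ltr0n.
  have jh : (j %/ h)%:R <= T%:R / (1 + eps) :> R.
    apply: (@le_trans _ _ (n%:R / h%:R)).
      rewrite ler_pdivlMr // -natrM ler_nat; apply: leq_trans (ltnW jn); exact: leq_divM.
    rewrite ler_pdivrMr // mulrAC ler_pdivlMr; last by lra.
    by move: (ltW h_gt); rewrite ler_pdivrMr // mulrC [h%:R * _]mulrC.
  apply: (@le_trans _ _ (T%:R - (j %/ h)%:R)).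
    have -> : eps / (1 + eps) * T%:R = T%:R - T%:R / (1 + eps) by field; lra.
    by rewrite lerD2l lerN2.
  by rewrite lerBlDr -natrD ler_nat addnC -leq_subLR.
Qed.

Lemma margin_near (R : realType) (c theta eps : R) (M : nat) :
  0 < theta -> theta < 1 -> 0 < c -> 0 < eps -> eps <= 24^-1 ->
  eps^-1 <= M.+1%:R ->
  \forall n \near \oo,
    let T := n_groups c theta M n in
    let h := stride eps T n in
    let kappa := h%:R * (sparsity theta n)%:R / n%:R in
    [/\ (0 < n)%N,
        3 * ln n%:R <= eps ^+ 2 / (1 + eps) * ((min_span c eps M n)%:R * kappa)
      & forall (s : labels n) (j : 'I_n),
        balanced h T (min_span c eps M n) eps kappa s ->
        n%:R * ((c * (1 - 10 * eps) - eps) * theta * ln n%:R) <= margin R M h T s j].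
Proof.
move=> t0 t1 c0 eps0 eps_le M_ge.
set B : R := M.+1%:R in M_ge *.
have B0 : 0 < B by rewrite ltr0n.
pose A := span_rate c eps M.
have A0 : 0 < A.
  by rewrite /A /span_rate mulr_gt0 ?divr_gt0 ?exprn_gt0 ?mulr_gt0 ?ltr0n //; lra.
pose c3 := eps / (1 + eps) * (c / (B * (1 + eps)) / 2).
have c30 : 0 < c3.
  by rewrite /c3 mulr_gt0 ?divr_gt0 ?mulr_gt0 //; lra.
have et0 : 0 < eps * theta by rewrite mulr_gt0.
near=> n.
have n0 : (0 < n)%N by near: n; exact: nbhs_infty_gt.
have E1 : 2 * (B * (1 + eps)) / (c * eps) + 2 <= theta * ln n%:R.
  by rewrite -ler_pdivrMl //; near: n; exact: near_le_ln.
have E2 : c / (B * eps) <= (1 - theta) * ln n%:R.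
  by rewrite -ler_pdivrMl ?subr_gt0 //; near: n; exact: near_le_ln.
have E3 : (4 * A + 4) / (eps * theta) ^+ 2 + 1 <= ln n%:R by near: n; exact: near_le_ln.
have E4 : B <= theta * ln n%:R by rewrite -ler_pdivrMl //; near: n; exact: near_le_ln.
have E5 : - ln c3 <= eps * theta * ln n%:R.
  by rewrite -ler_pdivrMl //; near: n; exact: near_le_ln.
have E6 : 1 <= ln n%:R :> R by near: n; exact: near_le_ln.
set k := sparsity theta n; set T := n_groups c theta M n.
set h := stride eps T n; set kappa := h%:R * k%:R / n%:R.
set y := ln n%:R in E1 E2 E3 E4 E5 E6 *.
have y0 : 0 < y by lra.
have nR : 0 < n%:R :> R by rewrite ltr0n.
have eps1 : eps <= 1 by lra.
have [k_ge k0 T_ge] := n_groups_ge c0 eps0 t0 n0 E1.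
have [kap_ge kap_le kn tail_ge] := stride_bounds c0 eps0 eps1 t0 n0 E1 E2.
rewrite -/T -/k -/h -/kappa -/B -/y in k_ge k0 T_ge kap_ge kap_le kn tail_ge.
set q0 := min_span c eps M n.
have kap0 : 0 < kappa by apply: lt_le_trans kap_ge; rewrite divr_gt0.
have q0_gt : A * y < q0%:R by rewrite truncnS_gt.
have q0_le : q0%:R <= A * y + 1.
  by rewrite /q0 /min_span -natr1 lerD2r truncn_le mulr_ge0 // ltW.
have q0k : 3 * (1 + eps) / eps ^+ 2 * y <= q0%:R * kappa.
  apply: (@le_trans _ _ (A * y * (B / c))); last first.
    apply: ler_pM (ltW q0_gt) kap_ge; first by rewrite mulr_ge0 // ltW.
    by rewrite divr_ge0 ?(ltW B0) ?(ltW c0).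
  by rewrite le_eqVlt; apply/orP; left; apply/eqP; rewrite /A /span_rate -/B; field; lra.
have e2 : 0 < eps ^+ 2 by rewrite exprn_gt0.
split => //.
  apply: (@le_trans _ _ (eps ^+ 2 / (1 + eps) * (3 * (1 + eps) / eps ^+ 2 * y))).
    by rewrite le_eqVlt; apply/orP; left; apply/eqP; field; lra.
  by rewrite ler_wpM2l // divr_ge0 ?(ltW e2) //; lra.
move=> s j bal.
have h0 : (0 < h)%N by [].
have lnq0 : ln q0%:R <= eps * theta * y.
  apply: le_trans (ln_le_linear A0 et0 E3); rewrite ler_ln ?posrE //.
  by apply: addr_gt0 => //; apply: mulr_gt0.
(* At least [c3 * n^theta] groups lie beyond [j], and the constant [c3] is absorbed by [eps] for
   large [n]. *)
have lnS : (1 - eps) * theta * y <= ln (T - j %/ h).+1%:R.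
  apply: (@le_trans _ _ (ln (c3 * expR (theta * y)))).
    by rewrite lnM ?posrE ?expR_gt0 // expRK; lra.
  have ce0 : 0 < c3 * expR (theta * y) by rewrite mulr_gt0 ?expR_gt0.
  rewrite ler_ln ?posrE //.
  apply: (@le_trans _ _ (T - j %/ h)%:R); last by rewrite ler_nat.
  apply: le_trans (tail_ge j (ltn_ord j)); rewrite /c3 -mulrA ler_wpM2l //.
    by rewrite divr_ge0 ?(ltW eps0) //; lra.
  apply: le_trans T_ge; rewrite -[leLHS]mulrA [leRHS]mulrAC.
  rewrite ler_wpM2l //; last by rewrite mulrC.
  by rewrite divr_ge0 ?mulr_ge0 ?(ltW c0) ?(ltW B0) //; lra.
have q0big : 1 <= eps * (q0%:R * kappa).
  apply: (@le_trans _ _ (eps * (3 * (1 + eps) / eps ^+ 2 * y))); last first.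
    by rewrite ler_wpM2l // ltW.
  have -> : eps * (3 * (1 + eps) / eps ^+ 2 * y) = 3 * (1 + eps) * y / eps by field; lra.
  by rewrite ler_pdivlMr //; nra.
have qT : (q0 <= (T - j %/ h).+1)%N.
  rewrite -(ler_nat R) -ler_ln ?posrE ?ltr0n //; apply: le_trans lnq0 _.
  apply: le_trans lnS; have : 0 <= theta * y by rewrite mulr_ge0 // ltW.
  by nra.
have := margin_ge M h0 (isT : (0 < q0)%N) eps0 kap0 q0big qT bal.
apply: le_trans.
(* The total rounding loss is at most [c k], of lower order than [n ln n]. *)
have MT : M%:R * T%:R <= n%:R * (eps * (theta * y)).
  apply: (@le_trans _ _ (c * k%:R)).
    apply: le_trans (n_groups_le theta M n (ltW c0)); rewrite natrM mulrC ler_wpM2l //.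
    by rewrite ler_nat.
  have {}kn : c * k%:R <= B * eps * n%:R by rewrite -ler_pdivrMr.
  apply: le_trans kn _; rewrite mulrC ler_wpM2l // mulrC.
  by rewrite ler_wpM2l // ltW.
rewrite [leRHS]mulrBr; apply: le_trans (lerB (lexx _) MT).
have dl : (1 - 2 * eps) * (theta * y) <= ln (T - j %/ h).+1%:R - ln q0%:R.
  by move: lnS lnq0; set a := ln _; set b := ln _; lra.
have d0 : 0 < (1 + 3 * eps) * kappa by rewrite mulr_gt0 //; lra.
(* The full pool takes a share [1 / M.+1] of its group, at most [eps]. *)
have MB : (1 - eps) * B <= M%:R.
  have -> : B = M%:R + 1 by rewrite natr1.
  have : 1 <= eps * (M%:R + 1).
    by rewrite natr1 -ler_pdivrMl // mulr1.
  by lra.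
have ty0 : 0 < theta * y by rewrite mulr_gt0.
(* The relative losses add up to first order: 1 for full pools, 2 for the logarithms, 3 for
   concentration and 4 for [kappa]. *)
have coef : c * (1 - 10 * eps) <= M%:R / ((1 + 3 * eps) * kappa) * (1 - 2 * eps).
  apply: (@le_trans _ _ ((1 - eps) * B / ((1 + 3 * eps) * ((1 + 4 * eps) * (B / c)))
      * (1 - 2 * eps))).
    have -> : (1 - eps) * B / ((1 + 3 * eps) * ((1 + 4 * eps) * (B / c))) * (1 - 2 * eps)
        = c * ((1 - eps) * (1 - 2 * eps) / ((1 + 3 * eps) * (1 + 4 * eps))).
      by field; lra.
    rewrite ler_wpM2l ?(ltW c0) // ler_pdivlMr; first by nra.
    by rewrite mulr_gt0 //; lra.
  rewrite ler_wpM2r //; first by lra.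
  rewrite ler_pM //.
  - by rewrite mulr_ge0 ?(ltW B0) //; lra.
  - by rewrite invr_ge0 !mulr_ge0 ?invr_ge0 ?(ltW B0) ?(ltW c0) //; lra.
  - rewrite lef_pV2 ?posrE // ?mulr_gt0 ?invr_gt0 //; try lra.
    by rewrite ler_wpM2l //; lra.
have step : M%:R * (n%:R / ((1 + 3 * eps) * kappa) * ((1 - 2 * eps) * (theta * y)))
   <= M%:R * (n%:R / ((1 + 3 * eps) * kappa) * (ln (T - j %/ h).+1%:R - ln q0%:R)).
  by rewrite ler_wpM2l // ler_wpM2l ?divr_ge0 ?(ltW d0).
apply: le_trans (lerB step (lexx _)).
have -> : M%:R * (n%:R / ((1 + 3 * eps) * kappa) * ((1 - 2 * eps) * (theta * y)))
  = n%:R * ((M%:R / ((1 + 3 * eps) * kappa) * (1 - 2 * eps)) * (theta * y)) by ring.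
rewrite -mulrBr ler_wpM2l // -mulrA -mulrBl ler_wpM2r ?(ltW ty0) //.
by rewrite lerB.
Unshelve. all: by end_near. Qed.

(** * Choice of the threshold and vanishing failure probability *)

Lemma fraction_between (R : realType) (lo hi : R) : 0 <= lo -> lo < hi ->
  exists A b : nat, [/\ (0 < b)%N, lo < A%:R / b%:R & A%:R / b%:R < hi].
Proof.
move=> lo0 lohi; pose b := (Num.truncn (hi - lo)^-1).+1.
have d0 : 0 < hi - lo by rewrite subr_gt0.
have b0 : 0 < b%:R :> R by rewrite ltr0n.
have b_gt : (hi - lo)^-1 < b%:R by rewrite truncnS_gt.
exists (Num.truncn (lo * b%:R)).+1, b; split => //.
  by rewrite ltr_pdivlMr // truncnS_gt.
rewrite ltr_pdivrMr // -natr1.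
have : (Num.truncn (lo * b%:R))%:R <= lo * b%:R by rewrite truncn_le mulr_ge0.
have : 1 < b%:R * (hi - lo) by rewrite -ltr_pdivrMr // div1r.
by rewrite mulrBr; lra.
Qed.

(* The threshold [A / b] is close to [1 / (1 + sqrt theta)], which makes the union
   bounds over the [n] items of label zero and over the [k] items of label one
   fail at the same number of pools. *)
Lemma threshold_exists (R : realType) (theta delta : R) :
  0 < theta -> 0 < delta ->
  exists A b : nat, [/\ (0 < b)%N, A%:R / b%:R <= 1 :> R,
    1 < (A%:R / b%:R) ^+ 2 / 2 * (2 * (1 + Num.sqrt theta) ^+ 2 * (1 + delta / 2))
    & theta < (1 - A%:R / b%:R) ^+ 2 / 2
        * (2 * (1 + Num.sqrt theta) ^+ 2 * (1 + delta / 2))].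
Proof.
move=> t0 d0; set r := Num.sqrt theta.
have r0 : 0 < r by rewrite sqrtr_gt0.
pose v := Num.sqrt (1 + delta / 2).
have v2 : v ^+ 2 = 1 + delta / 2 by rewrite sqr_sqrtr //; lra.
have v0 : 0 <= v by rewrite sqrtr_ge0.
have v1 : 1 < v.
  by rewrite -(@ltr_pXn2r _ 2) ?nnegrE // expr1n v2; lra.
have uv0 : 0 < (1 + r) * v by rewrite mulr_gt0 //; lra.
have [||A [b [b0 lo hi]]] := @fraction_between R (1 / ((1 + r) * v)) (1 - r / ((1 + r) * v)).
- by rewrite divr_ge0 // ltW.
- rewrite ltrBrDr -mulrDl ltr_pdivrMr // mul1r; nra.
exists A, b; move: lo hi; move: (A%:R / b%:R) => a lo hi.
have a_gt : 1 < a * ((1 + r) * v) by rewrite -ltr_pdivrMr.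
have a_lt : r < (1 - a) * ((1 + r) * v) by rewrite -ltr_pdivrMr //; lra.
split => //.
- have : 0 < r / ((1 + r) * v) by rewrite divr_gt0.
  by lra.
- have -> : a ^+ 2 / 2 * (2 * (1 + r) ^+ 2 * (1 + delta / 2)) = (a * ((1 + r) * v)) ^+ 2.
    by rewrite !exprMn v2; field.
  rewrite -[ltLHS](expr1n R 2) ltr_pXn2r ?nnegrE ?ler01 //.
  exact: ltW (lt_trans ltr01 a_gt).
- have -> : (1 - a) ^+ 2 / 2 * (2 * (1 + r) ^+ 2 * (1 + delta / 2))
      = ((1 - a) * ((1 + r) * v)) ^+ 2.
    by rewrite !exprMn v2; field.
  rewrite -[theta]sqr_sqrtr ?(ltW t0) // -/r ltr_pXn2r ?nnegrE ?(ltW r0) //.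
  exact: ltW (lt_trans r0 a_lt).
Qed.

Lemma success_prob_le1 (R : realType) M h n T k (D : decoder n (T * M.+1)) :
  (k <= n)%N -> success_prob k (design_scheme R M h n T) D <= 1.
Proof.
move=> kn; rewrite -subr_ge0 failure_image_scheme ?ground_truths_gt0 //.
by rewrite divr_ge0 // sumr_ge0 // => s _; rewrite divr_ge0 // sumr_ge0.
Qed.

(** [nu] is the slack in the exponents of both union bounds. Zeros and ones contribute at most
    [n^(- nu)] each and unbalanced truths [c] times as much, whence [c + 2]. *)
Lemma failure_near (R : realType) (c theta eps nu : R) (A b M : nat) :
  0 < theta -> theta < 1 -> 0 < c -> 0 < eps -> eps <= 24^-1 ->
  eps^-1 <= M.+1%:R -> (0 < b)%N -> A%:R / b%:R <= 1 :> R -> nu <= 1 ->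
  1 + nu <= (A%:R / b%:R) ^+ 2 / 2 * ((c * (1 - 10 * eps) - eps) * theta) ->
  theta + nu <= (1 - A%:R / b%:R) ^+ 2 / 2 * ((c * (1 - 10 * eps) - eps) * theta) ->
  \forall n \near \oo,
    let T := n_groups c theta M n in
    1 - success_prob (sparsity theta n)
          (design_scheme R M (stride eps T n) n T) (greedy_decoder A b M T)
      <= (c + 2) * expR (- (nu * ln n%:R)).
Proof.
move=> t0 t1 c0 eps0 eps_le M_ge b0 a1 nu1 rate0 rate1.
set rate := (c * (1 - 10 * eps) - eps) * theta in rate0 rate1 *.
move: (margin_near t0 t1 c0 eps0 eps_le M_ge) (near_le_ln (0 : R)).
apply: filterS2 => n.
set k := sparsity theta n; set T := n_groups c theta M n.
set h := stride eps T n; set kappa := h%:R * k%:R / n%:R.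
set q0 := min_span c eps M n; set y := ln n%:R.
move=> [n0 q0k marg] y0.
have nR : 0 < n%:R :> R by rewrite ltr0n.
have nE : n%:R = expR y :> R by rewrite lnK // posrE.
have kn : (k <= n)%N by apply: sparsity_leq.
have gt0 := ground_truths_gt0 kn.
have kE : k%:R <= expR (theta * y) by rewrite -natr_powR // sparsity_le.
have T_le : T%:R <= c * expR y.
  apply: (@le_trans _ _ (c * k%:R)).
    apply: le_trans (n_groups_le theta M n (ltW c0)).
    by rewrite ler_nat leq_pmulr.
  by rewrite ler_wpM2l ?(ltW c0) // -nE ler_nat.
apply: le_trans (failure_bound (good := balanced h T q0 eps kappa) (L := rate * y)
  b0 n0 gt0 a1 _) _.
  by move=> s _ bal j; apply: marg.
have U := @unbalanced_count R h n k T q0 eps kappa kn n0 isT eps0 erefl.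
have bad : (\sum_(s in ground_truths n k) (~~ balanced h T q0 eps kappa s)%:R)
    / #|ground_truths n k|%:R <= c * expR (- (nu * y)).
  rewrite ler_pdivrMr ?ltr0n // mulrC; apply: le_trans U _; rewrite ler_wpM2l //.
  (* There are at most [c n^2] pairs of an item and a group, against a tail [n^(-3)]; the remaining
     [c / n] is small enough because [nu <= 1]. *)
  apply: (@le_trans _ _ (expR y * (c * expR y) * expR (- (3 * y)))).
    apply: ler_pM; rewrite ?mulr_ge0 ?expR_ge0 //.
      by rewrite nE ler_wpM2l ?expR_ge0.
    by rewrite ler_expR lerN2.
  rewrite mulrCA -!mulrA ler_wpM2l ?(ltW c0) // -!expRD ler_expR.
  by nra.
have zeros (x : R) : 1 + nu <= x -> n%:R * expR (- (x * y)) <= expR (- (nu * y)).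
  by move=> hx; rewrite nE -expRD ler_expR; nra.
have ones (x : R) : theta + nu <= x -> k%:R * expR (- (x * y)) <= expR (- (nu * y)).
  move=> hx; apply: (@le_trans _ _ (expR (theta * y) * expR (- (x * y)))).
    by rewrite ler_wpM2r ?expR_ge0.
  by rewrite -expRD ler_expR; nra.
have := zeros _ rate0; have := ones _ rate1; rewrite -!mulrA => H1 H0.
by move: bad H0 H1; lra.
Qed.

Lemma cvg_to_one (R : realType) (u : nat -> R) (C nu : R) :
  0 < C -> 0 < nu -> (forall n, u n <= 1) ->
  (\forall n \near \oo, 1 - u n <= C * expR (- (nu * ln n%:R))) ->
  u n @[n --> \oo] --> (1 : R).
Proof.
move=> C0 nu0 u1 bound; apply/cvgrPdist_le => e e0.
move: bound (near_le_ln (- ln (e / C) / nu)); apply: filterS2 => n un y_ge.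
rewrite ger0_norm ?subr_ge0 //; apply: le_trans un _.
rewrite -ler_pdivlMl // [leRHS]mulrC -[leRHS]lnK ?posrE ?divr_gt0 // ler_expR.
by move: y_ge; rewrite ler_pdivrMr // lerNl [nu * _]mulrC.
Qed.

Unset Implicit Arguments.

Theorem theorem1p1 (R : realType) (theta delta : R)
    (theta_gt0 : 0 < theta) (theta_lt1 : theta < 1) (delta_gt0 : 0 < delta) :
  exists (m : nat -> nat)
         (P : forall n, pooling_scheme R n (m n))
         (D : forall n, decoder n (m n)),
    [/\ forall n, (m n)%:R <=
          (1 + delta) * ((1 + Num.sqrt theta) / (1 - Num.sqrt theta))
          * m_QGT_inf theta n,
        poly_time (sparsity theta) D
      & success_prob (sparsity theta n) (P n) (D n) @[n --> \oo] --> (1 : R)].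
Proof.
have [A [b [b0 a1]]] := threshold_exists theta_gt0 delta_gt0.
set r := Num.sqrt theta => rate0 rate1.
have r0 : 0 < r by rewrite sqrtr_gt0.
have r2 : theta = r ^+ 2 by rewrite sqr_sqrtr // ltW.
have r1 : r < 1 by rewrite -(@ltr_pXn2r _ 2) ?nnegrE ?(ltW r0) // expr1n -r2.
(* The allowed number of pools is [c k]. As [1 - theta = (1 - r) (1 + r)], the product [c theta] is
   [2 (1 + delta) (1 + r)^2]. *)
pose c := (1 + delta) * ((1 + r) / (1 - r)) * (2 * ((1 - theta) / theta)).
(* The losses [10 eps] and [eps] in [rate] consume at most [11 / 24] of [delta], which leaves the
   [delta / 2] that the threshold was chosen for. *)
pose eps := delta / (24 * (1 + delta)).
pose M := Num.truncn eps^-1.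
have cE : c * theta = (1 + delta) * (2 * (1 + r) ^+ 2).
  by rewrite /c r2; field; lra.
have c0 : 0 < c by rewrite -(pmulr_lgt0 _ theta_gt0) cE !mulr_gt0 ?exprn_gt0 //; lra.
have eps0 : 0 < eps by rewrite divr_gt0 // mulr_gt0 //; lra.
have eps_le : eps <= 24^-1 by rewrite ler_pdivrMr ?mulr_gt0 //; lra.
have M_ge : eps^-1 <= M.+1%:R by rewrite ltW // truncnS_gt.
pose rate := (c * (1 - 10 * eps) - eps) * theta.
have rate_ge : 2 * (1 + r) ^+ 2 * (1 + delta / 2) <= rate.
  have epsE : 24 * ((1 + delta) * eps) = delta by rewrite /eps; field; lra.
  have -> : rate = (1 + delta) * (2 * (1 + r) ^+ 2) - (2 * (1 + r) ^+ 2)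
      * (10 * ((1 + delta) * eps)) - eps * theta.
    by have := congr1 ( *%R eps) cE; rewrite /rate; lra.
  set S := 2 * (1 + r) ^+ 2.
  have S2 : 1 <= S by rewrite /S; nra.
  have : eps * theta <= delta / 24 * S.
    have : eps <= delta / 24 by rewrite -epsE; nra.
    by nra.
  have -> : (1 + delta) * eps = delta / 24 by move: epsE; lra.
  by nra.
pose nu := Num.min 1 (Num.min ((A%:R / b%:R) ^+ 2 / 2 * rate - 1)
                               ((1 - A%:R / b%:R) ^+ 2 / 2 * rate - theta)).
have nu0 : 0 < nu.
  rewrite !lt_min ltr01 !subr_gt0 /=; apply/andP; split.
    by apply: lt_le_trans rate0 _; rewrite ler_wpM2l // divr_ge0 ?sqr_ge0.
  by apply: lt_le_trans rate1 _; rewrite ler_wpM2l // divr_ge0 ?sqr_ge0.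
have nu1 : nu <= 1 by rewrite ge_min lexx.
have nu2 : 1 + nu <= (A%:R / b%:R) ^+ 2 / 2 * rate.
  by rewrite -lerBrDl !ge_min lexx orbT.
have nu3 : theta + nu <= (1 - A%:R / b%:R) ^+ 2 / 2 * rate.
  by rewrite -lerBrDl !ge_min lexx !orbT.
pose T := n_groups c theta M.
exists (fun n => T n * M.+1)%N,
  (fun n => design_scheme R M (stride eps (T n) n) n (T n)),
  (fun n => greedy_decoder A b M (T n)); split.
- move=> n; apply: le_trans (n_groups_le theta M n (ltW c0)) _.
  by rewrite /m_QGT_inf [leRHS]mulrA.
- apply: (@poly_time_greedy A b M (Num.truncn c).+1 _ T) => // n.
  rewrite -(ler_nat R); apply: le_trans (n_groups_le theta M n (ltW c0)) _.
  rewrite natrM ler_pM ?(ltW c0) ?ler0n //; first by rewrite ltW // truncnS_gt.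
  by rewrite ler_nat sparsity_leq.
- apply: (@cvg_to_one R _ (c + 2) nu) => //; first by rewrite addr_gt0.
    by move=> n; rewrite success_prob_le1 // sparsity_leq.
  exact: (failure_near (nu := nu) theta_gt0 theta_lt1 c0 eps0 eps_le M_ge
    b0 a1 nu1).
Qed.
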